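(* (In Internal Set Theory.) Let $d$ be a standard positive integer, $r\ge0$ a standard real, $\mathcal{C}=\mathcal{C}([-r,0],\mathbb{R}^d)$, let $\phi\in\mathcal{C}$ be standard and let $F:\mathbb{R}_+\times\mathcal{C}\to\mathbb{R}^d$ be a standard and continuous function. Let $I$ be a subset of $\mathbb{R}$ with $[-r,0]\subset I$ and let $x:I\to\mathbb{R}^d$ be a function (continuous if $r>0$) with $x_0\simeq\phi$ in $\mathcal{C}$. Suppose that: (a) the function $x$ satisfies the $F$-stroboscopic property; (b) the initial value problem $\dot y(t)=F(t,y_t)$, $y_0=\phi$, has a unique solution $y$; let $J=[-r,\omega)$, $0<\omega\le\infty$, be its maximal interval of definition. Then, for every standard and positive $L\in J$, $[-r,L]\subset I$ and $x(t)\simeq y(t)$ for all $t\in[-r,L]$.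
   Context: We work in Nelson's Internal Set Theory (IST): ZFC with an additional unary predicate ''standard'' and the axiom schemes of Idealization, Standardization and Transfer. Sets and functions are arbitrary (internal) objects of IST, not assumed standard unless stated. A real number is infinitesimal if its absolute value is less than every standard positive real, limited if its absolute value is at most some standard positive real, and unlimited otherwise. A vector of a standard normed space is infinitesimal (limited, unlimited) if its norm is; $x\simeq y$ means that $x-y$ is infinitesimal. $\mathbb{R}_+=[0,\infty)$. $\mathcal{C}$ is the Banach space of continuous functions $[-r,0]\to\mathbb{R}^d$ with the sup norm (identified with $\mathbb{R}^d$ when $r=0$), and $x_t\in\mathcal{C}$ is defined by $x_t(\theta)=x(t+\theta)$, $\theta\in[-r,0]$ (identified with $x(t)$ when $r=0$). $F$-stroboscopic property: the function $x:I\to\mathbb{R}^d$ is said to satisfy it if there exists $\mu>0$ such that, for all limited $t\ge0$ in $I$ satisfying $[0,t]\subset I$ and $x(s)$ and $F(s,x_s)$ limited for all $s\in[0,t]$, there exists $t'\in I$ such that $\mu<t'-t\simeq0$, $[t,t']\subset I$, $x(s)\simeq x(t)$ for all $s\in[t,t']$, and $\frac{x(t')-x(t)}{t'-t}\simeq F(t,x_t)$. ($\mu$ may be infinitesimal.) A solution of the retarded problem is a continuous function on an interval starting at $-r$, equal to $\phi$ on $[-r,0]$ and satisfying the equation for $t\ge0$. ''Unique solution'' means that there is exactly one maximal (non-continuable to the right) solution and every solution is a restriction of it. *)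

(* Defs.v *)
From Stdlib Require Import ClassicalEpsilon.

(* Internal Set Theory is a first-order theory in the language {=, ∈, standard}.
   A theorem of IST is stated here as a property of every model of IST: the
   axiom schemes range over the deep-embedded formulas below, and all the
   mathematics (numbers, functions, spaces) takes place inside the model.  In
   particular, a quantifier over the elements of the model ranges over all
   internal objects, standard or not. *)

Structure universe := Universe {
  obj :> Type;
  obj_inhabited : inhabited obj;
  mem : obj -> obj -> Prop;
  standard : obj -> Prop
}.

Arguments mem {u} _ _.
Arguments standard {u} _.

Declare Scope ist_scope.
Delimit Scope ist_scope with ist.
Notation "x ∈ A" := (mem x A) (at level 70, no associativity) : ist_scope.
Local Open Scope ist_scope.

(* Formulas, with de Bruijn indices. *)

Inductive formula : Type :=
| fMem (i j : nat)
| fEq (i j : nat)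
| fStd (i : nat)
| fFalse
| fImp (f g : formula)
| fAll (f : formula).

Fixpoint internal (f : formula) : Prop :=
  match f with
  | fMem _ _ | fEq _ _ | fFalse => True
  | fStd _ => False
  | fImp g h => internal g /\ internal h
  | fAll g => internal g
  end.

Fixpoint free (n : nat) (f : formula) : Prop :=
  match f with
  | fMem i j | fEq i j => n = i \/ n = j
  | fStd i => n = i
  | fFalse => False
  | fImp g h => free n g \/ free n h
  | fAll g => free (S n) g
  end.

Definition push {T : Type} (v : T) (e : nat -> T) (n : nat) : T :=
  match n with O => v | S m => e m end.

Fixpoint sat {U : universe} (e : nat -> U) (f : formula) : Prop :=
  match f with
  | fMem i j => e i ∈ e j
  | fEq i j => e i = e j
  | fStd i => standard (e i)
  | fFalse => False
  | fImp g h => sat e g -> sat e h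
  | fAll g => forall v : U, sat (push v e) g
  end.

(* Set-theoretic vocabulary.  [the P] is the unique object satisfying [P]; it
   is the empty set when there is no such object, so that every term below
   abbreviates a definable operation even outside its intended domain. *)

Definition the {U : universe} (P : U -> Prop) : U :=
  epsilon (obj_inhabited U)
    (fun z => unique P z \/ (~ (exists! y, P y) /\ forall w, ~ w ∈ z)).

Definition setof {U : universe} (P : U -> Prop) : U :=
  the (fun z => forall w, w ∈ z <-> P w).

Definition subset {U : universe} (A B : U) : Prop := forall w, w ∈ A -> w ∈ B.

Definition empty {U : universe} : U := setof (fun _ => False).

Definition upair {U : universe} (a b : U) : U := setof (fun w => w = a \/ w = b).

Definition opair {U : universe} (a b : U) : U := upair (upair a a) (upair a b).

Definition prod {U : universe} (A B : U) : U :=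
  setof (fun p => exists a b, a ∈ A /\ b ∈ B /\ p = opair a b).

Definition is_fun {U : universe} (f A B : U) : Prop :=
  (forall p, p ∈ f -> exists a b, a ∈ A /\ b ∈ B /\ p = opair a b) /\
  (forall a, a ∈ A -> exists! b, opair a b ∈ f).

Definition funs {U : universe} (A B : U) : U := setof (fun f => is_fun f A B).

Definition ap {U : universe} (f a : U) : U := the (fun b => opair a b ∈ f).

Definition lam {U : universe} (A : U) (g : U -> U) : U :=
  setof (fun p => exists a, a ∈ A /\ p = opair a (g a)).

Definition inductive_set {U : universe} (W : U) : Prop :=
  (exists z, z ∈ W /\ forall w, ~ w ∈ z) /\
  (forall n, n ∈ W ->
     exists m, m ∈ W /\ forall w, w ∈ m <-> (w ∈ n \/ w = n)).

Definition omega {U : universe} : U :=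
  setof (fun n => forall W, inductive_set W -> n ∈ W).

Definition finite_set {U : universe} (A : U) : Prop :=
  exists n f, n ∈ omega /\ is_fun f n A /\
    forall b, b ∈ A -> exists! a, opair a b ∈ f.

Record ZFC (U : universe) : Prop := {
  zfc_extensionality : forall A B : U, (forall w, w ∈ A <-> w ∈ B) -> A = B;
  zfc_foundation : forall A : U, (exists w, w ∈ A) ->
    exists m, m ∈ A /\ forall w, w ∈ m -> ~ w ∈ A;
  zfc_pairing : forall a b : U, exists A, forall w, w ∈ A <-> (w = a \/ w = b);
  zfc_union : forall A : U, exists B, forall w,
    w ∈ B <-> exists a, a ∈ A /\ w ∈ a;
  zfc_powerset : forall A : U, exists B, forall w, w ∈ B <-> subset w A;
  zfc_infinity : exists W : U, inductive_set W;
  zfc_separation : forall (f : formula) (e : nat -> U) (A : U), internal f ->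
    exists B, forall w, w ∈ B <-> (w ∈ A /\ sat (push w e) f);
  zfc_replacement : forall (f : formula) (e : nat -> U) (A : U), internal f ->
    (forall a, a ∈ A -> exists! b, sat (push b (push a e)) f) ->
    exists B, forall b,
      b ∈ B <-> exists a, a ∈ A /\ sat (push b (push a e)) f;
  zfc_choice : forall A : U,
    (forall a, a ∈ A -> exists w, w ∈ a) ->
    (forall a b, a ∈ A -> b ∈ A -> (exists w, w ∈ a /\ w ∈ b) -> a = b) ->
    exists C, forall a, a ∈ A -> exists! w, w ∈ a /\ w ∈ C
}.

(* The parameters of the schemes are given by the environment [e]: arbitrary
   for idealization and standardization, standard for transfer.
   Standardization is the only scheme that admits external formulas. *)

Record IST (U : universe) : Prop := {
  ist_zfc : ZFC U;
  ist_transfer : forall (f : formula) (e : nat -> U), internal f ->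
    (forall n, free (S n) f -> standard (e n)) ->
    (forall x : U, standard x -> sat (push x e) f) ->
    forall x : U, sat (push x e) f;
  ist_idealization : forall (f : formula) (e : nat -> U), internal f ->
    (forall A : U, standard A -> finite_set A ->
       exists x, forall y, y ∈ A -> sat (push x (push y e)) f) <->
    (exists x, forall y : U, standard y -> sat (push x (push y e)) f);
  ist_standardization : forall (f : formula) (e : nat -> U) (A : U),
    standard A ->
    exists B : U, standard B /\
      forall z, standard z -> (z ∈ B <-> (z ∈ A /\ sat (push z e) f))
}.

(* The real line of the model: a standard complete ordered field.  Any two of
   them are isomorphic through a unique, hence standard, isomorphism.
   Completeness concerns the sets of the model only. *)

Class real_data (U : universe) := RealData {
  RR : U;
  rzero : U;
  rone : U;
  radd_graph : U;
  rmul_graph : U;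
  rle_graph : U
}.

Definition radd {U : universe} {K : real_data U} (a b : U) : U :=
  ap radd_graph (opair a b).
Definition rmul {U : universe} {K : real_data U} (a b : U) : U :=
  ap rmul_graph (opair a b).
Definition rle {U : universe} {K : real_data U} (a b : U) : Prop :=
  opair a b ∈ rle_graph.
Definition rlt {U : universe} {K : real_data U} (a b : U) : Prop :=
  rle a b /\ a <> b.

Notation "0" := rzero : ist_scope.
Notation "1" := rone : ist_scope.
Infix "+" := radd : ist_scope.
Infix "*" := rmul : ist_scope.
Infix "<=" := rle : ist_scope.
Infix "<" := rlt : ist_scope.

Definition ropp {U : universe} {K : real_data U} (a : U) : U :=
  the (fun b => b ∈ RR /\ a + b = 0).
Notation "- a" := (ropp a) : ist_scope.

Definition rsub {U : universe} {K : real_data U} (a b : U) : U := a + - b.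
Infix "-" := rsub : ist_scope.

Definition rdiv {U : universe} {K : real_data U} (a b : U) : U :=
  the (fun c => c ∈ RR /\ c * b = a).
Infix "/" := rdiv : ist_scope.

Definition rabs {U : universe} {K : real_data U} (a : U) : U :=
  the (fun b => (0 <= a /\ b = a) \/ (a < 0 /\ b = - a)).

Definition is_lub {U : universe} {K : real_data U} (P : U -> Prop) (c : U) : Prop :=
  c ∈ RR /\ (forall a, P a -> a <= c) /\
  (forall b, b ∈ RR -> (forall a, P a -> a <= b) -> c <= b).

Definition rsup {U : universe} {K : real_data U} (P : U -> Prop) : U :=
  the (is_lub P).

Record is_real_line (U : universe) (K : real_data U) : Prop := {
  real_zero : 0 ∈ RR;
  real_one : 1 ∈ RR;
  real_add : is_fun radd_graph (prod RR RR) RR;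
  real_mul : is_fun rmul_graph (prod RR RR) RR;
  real_le : subset rle_graph (prod RR RR);
  real_addC : forall a b, a ∈ RR -> b ∈ RR -> a + b = b + a;
  real_addA : forall a b c, a ∈ RR -> b ∈ RR -> c ∈ RR ->
    a + (b + c) = (a + b) + c;
  real_add0 : forall a, a ∈ RR -> a + 0 = a;
  real_addN : forall a, a ∈ RR -> exists b, b ∈ RR /\ a + b = 0;
  real_mulC : forall a b, a ∈ RR -> b ∈ RR -> a * b = b * a;
  real_mulA : forall a b c, a ∈ RR -> b ∈ RR -> c ∈ RR ->
    a * (b * c) = (a * b) * c;
  real_mul1 : forall a, a ∈ RR -> a * 1 = a;
  real_mulV : forall a, a ∈ RR -> a <> 0 -> exists b, b ∈ RR /\ a * b = 1;
  real_mulD : forall a b c, a ∈ RR -> b ∈ RR -> c ∈ RR ->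
    a * (b + c) = a * b + a * c;
  real_one_neq_zero : 1 <> 0;
  real_le_refl : forall a, a ∈ RR -> a <= a;
  real_le_anti : forall a b, a <= b -> b <= a -> a = b;
  real_le_trans : forall a b c, a <= b -> b <= c -> a <= c;
  real_le_total : forall a b, a ∈ RR -> b ∈ RR -> a <= b \/ b <= a;
  real_le_add : forall a b c, c ∈ RR -> a <= b -> a + c <= b + c;
  real_le_mul : forall a b, 0 <= a -> 0 <= b -> 0 <= a * b;
  real_complete : forall A, subset A RR -> (exists a, a ∈ A) ->
    (exists b, b ∈ RR /\ forall a, a ∈ A -> a <= b) ->
    exists c, is_lub (fun a => a ∈ A) c;
  real_standard : standard RR /\ standard rzero /\ standard rone /\
    standard radd_graph /\ standard rmul_graph /\ standard rle_graph
}.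

Definition infinitesimal {U : universe} {K : real_data U} (a : U) : Prop :=
  forall eps, eps ∈ RR -> standard eps -> 0 < eps -> rabs a < eps.

Definition limited {U : universe} {K : real_data U} (a : U) : Prop :=
  exists c, c ∈ RR /\ standard c /\ 0 < c /\ rabs a <= c.

Definition Icc {U : universe} {K : real_data U} (a b : U) : U :=
  setof (fun t => t ∈ RR /\ a <= t /\ t <= b).
Definition Ico {U : universe} {K : real_data U} (a b : U) : U :=
  setof (fun t => t ∈ RR /\ a <= t /\ t < b).
Definition Ici {U : universe} {K : real_data U} (a : U) : U :=
  setof (fun t => t ∈ RR /\ a <= t).

(* R^d, for a natural number d of the model, is the set of functions from the
   von Neumann ordinal d = {0, ..., d-1} to the reals, with the norm
   max_i |v_i|. *)

Definition Rvec {U : universe} {K : real_data U} (d : U) : U := funs d RR.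

Definition vsub {U : universe} {K : real_data U} (d u v : U) : U :=
  lam d (fun i => ap u i - ap v i).
Definition vdiv {U : universe} {K : real_data U} (d u c : U) : U :=
  lam d (fun i => ap u i / c).
Definition vnorm {U : universe} {K : real_data U} (d v : U) : U :=
  rsup (fun a => exists i, i ∈ d /\ a = rabs (ap v i)).

Definition vlimited {U : universe} {K : real_data U} (d v : U) : Prop :=
  limited (vnorm d v).
Definition vnear {U : universe} {K : real_data U} (d u v : U) : Prop :=
  infinitesimal (vnorm d (vsub d u v)).

Definition continuous_on {U : universe} {K : real_data U} (d A x : U) : Prop :=
  forall t, t ∈ A -> forall eps, eps ∈ RR -> 0 < eps ->
  exists delta, delta ∈ RR /\ 0 < delta /\
    forall s, s ∈ A -> rabs (s - t) < delta ->
      vnorm d (vsub d (ap x s) (ap x t)) < eps.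

(* C([-r,0], R^d); when r = 0 this is the set of functions {0} -> R^d, which
   is isometric to R^d through evaluation at 0. *)

Definition Cspace {U : universe} {K : real_data U} (d r : U) : U :=
  setof (fun p => is_fun p (Icc (- r) 0) (Rvec d) /\
                  continuous_on d (Icc (- r) 0) p).

Definition Csub {U : universe} {K : real_data U} (d r p q : U) : U :=
  lam (Icc (- r) 0) (fun theta => vsub d (ap p theta) (ap q theta)).
Definition Cnorm {U : universe} {K : real_data U} (d r p : U) : U :=
  rsup (fun a => exists theta, theta ∈ Icc (- r) 0 /\ a = vnorm d (ap p theta)).
Definition Cnear {U : universe} {K : real_data U} (d r p q : U) : Prop :=
  infinitesimal (Cnorm d r (Csub d r p q)).

(* The segment x_t : theta |-> x(t + theta). *)
Definition seg {U : universe} {K : real_data U} (r x t : U) : U :=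
  lam (Icc (- r) 0) (fun theta => ap x (t + theta)).

Definition continuous_functional {U : universe} {K : real_data U}
    (d r F : U) : Prop :=
  forall t p, t ∈ Ici 0 -> p ∈ Cspace d r ->
  forall eps, eps ∈ RR -> 0 < eps ->
  exists delta, delta ∈ RR /\ 0 < delta /\
    forall s q, s ∈ Ici 0 -> q ∈ Cspace d r ->
      rabs (s - t) < delta -> Cnorm d r (Csub d r q p) < delta ->
      vnorm d (vsub d (ap F (opair s q)) (ap F (opair t p))) < eps.

Definition stroboscopic {U : universe} {K : real_data U}
    (d r F I x : U) : Prop :=
  exists mu, mu ∈ RR /\ 0 < mu /\
  forall t, t ∈ I -> 0 <= t -> limited t -> subset (Icc 0 t) I ->
  (forall s, s ∈ Icc 0 t ->
     vlimited d (ap x s) /\ vlimited d (ap F (opair s (seg r x s)))) ->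
  exists t', t' ∈ I /\ mu < t' - t /\ infinitesimal (t' - t) /\
    subset (Icc t t') I /\
    (forall s, s ∈ Icc t t' -> vnear d (ap x s) (ap x t)) /\
    vnear d (vdiv d (vsub d (ap x t') (ap x t)) (t' - t))
            (ap F (opair t (seg r x t))).

(* Derivative relative to A: one-sided at an end point of an interval A. *)
Definition has_derivative {U : universe} {K : real_data U}
    (d A y t v : U) : Prop :=
  forall eps, eps ∈ RR -> 0 < eps ->
  exists delta, delta ∈ RR /\ 0 < delta /\
    forall s, s ∈ A -> s <> t -> rabs (s - t) < delta ->
      vnorm d (vsub d (vdiv d (vsub d (ap y s) (ap y t)) (s - t)) v) < eps.

Definition interval_from {U : universe} {K : real_data U} (a D : U) : Prop :=
  subset D RR /\ a ∈ D /\ (forall t, t ∈ D -> a <= t) /\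
  (forall s t u, s ∈ D -> t ∈ D -> s <= u -> u <= t -> u ∈ D).

(* D contains some T > 0, so that the equation at t = 0 is a genuine condition
   on the right derivative. *)
Definition solution {U : universe} {K : real_data U}
    (d r F phi y D : U) : Prop :=
  interval_from (- r) D /\ (exists T, T ∈ D /\ 0 < T) /\
  is_fun y D (Rvec d) /\ continuous_on d D y /\
  (forall theta, theta ∈ Icc (- r) 0 -> ap y theta = ap phi theta) /\
  (forall t, t ∈ D -> 0 <= t ->
     has_derivative d (setof (fun s => s ∈ D /\ 0 <= s)) y t
       (ap F (opair t (seg r y t)))).

(* A function being the set of its pairs, z extends y iff y is a subset of z. *)

Definition maximal_solution {U : universe} {K : real_data U}
    (d r F phi y D : U) : Prop :=
  solution d r F phi y D /\
  forall z E, solution d r F phi z E -> subset y z -> z = y.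

Definition unique_solution {U : universe} {K : real_data U}
    (d r F phi y D : U) : Prop :=
  maximal_solution d r F phi y D /\
  (forall z E, maximal_solution d r F phi z E -> z = y) /\
  (forall z E, solution d r F phi z E -> subset z y).

(* Main.v *)
(* The predicates that can be transferred, separated or standardized are those given by
   formulas of the model, so one first shows that the predicates needed below are definable,
   and that the real line of the model is an ordered field, complete for definable sets.

   By transfer and uniqueness, y is standard.  Call a time t <= L good when x stays within
   e0 of y on [0, t], where e0 is standard and so small that F(t, x_t) stays limited at good
   times (underspill).  By overspill the stroboscopic property provides, uniformly over the
   good times, steps of infinitesimal length > mu along which x moves with slope F(t, x_t) up
   to an infinitesimal del.  A supremum argument then gives an Euler-type estimate
   |x(b) - x(a) - (b - a) v| <= (b - a) (e + del) + del (1 + |v|) as soon as F(s, x_s) is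
   within e of v on [a, b]; in particular x is S-continuous.  Let w0 be the standard part of
   the supremum T of the good times.  The standard function z whose values at standard
   t < w0 are the standard parts of x(t) is continuous, and the estimate together with the
   continuity of F at the points (t, z_t) shows that z solves the problem on [-r, w0), hence
   z = y there by uniqueness.  So x is infinitely close to y at all good times, one more step
   leaves x within e0 of y beyond T, and therefore L itself is good. *)

(* Two restrictions shape the proof. Suprema, spilling and transfer accept internal predicates only,
   so a condition such as [near] has to become an inequality with an explicit bound before it enters
   them: hence [good] compares with a number [e], and the errors of a step are packed into the
   single number [del]. Moreover the stroboscopic instants come from a bare existence statement and
   are never assembled into a sequence. The lower bound [mu] on the steps, however small, replaces
   it: a time within [mu] of a supremum is carried past it by one step.

   Continuity of [F] is used at standard points only, so values at other times are always compared
   through a standard time. The shadow lives on a half-open interval, as nothing is known at [w0]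
   itself; times near [w0], and the case [w0 = 0], therefore need arguments of their own.

   Vectors are treated by coordinates. The indices are standard, being elements of the standard
   natural number [d], and may occur as parameters in transfer. The positive infinitesimal on which
   spilling relies is at first the length of the step taken at time 0, later [del]. *)
From HB Require Import structures.
From mathcomp Require Import all_boot all_order all_algebra boolp ring lra.
From Stdlib Require Import ClassicalEpsilon.
Require Import Defs.
Set Implicit Arguments.
Unset Strict Implicit.
Unset Printing Implicit Defensive.
Import Order.TTheory GRing.Theory Num.Theory.
Local Open Scope ist_scope.

(** * Definability by internal formulas *)

(* Models are bundled with their axioms, so that unification supplies the latter. *)
Structure ist_model := IstModel {
  ist_universe :> universe;
  ist_axioms : IST ist_universe
}.

Section Definability.
Variable U : ist_model.
Local Notation HU := (ist_axioms U).

(** The free variables of a predicate, as nested pairs: binding a variable is pairing, so the body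
    of a quantifier is again a predicate on a context. *)
Fixpoint ctx (k : nat) : Type := if k is k'.+1 then (U * ctx k')%type else unit.

Definition ctop (k : nat) (c : ctx k.+1) : U := c.1.
Definition cpop (k : nat) (c : ctx k.+1) : ctx k := c.2.
Definition cpush (k : nat) (u : U) (c : ctx k) : ctx k.+1 := (u, c).

(* The de Bruijn environment listing a context, followed by parameters. *)
Fixpoint env (k : nat) : ctx k -> (nat -> U) -> nat -> U :=
  if k is k'.+1 then fun c p => push c.1 (env c.2 p) else fun _ p => p.

(* [definable b P]: some internal formula defines [P], with parameters that are
   standard when [b] is true. *)
Definition definable (b : bool) (k : nat) (P : ctx k -> Prop) : Prop :=
  exists f p, [/\ internal f, forall n, b -> standard (p n : U)
                & forall c, sat (env c p) f <-> P c].

(** The language has no function symbols, so a term counts as definable when its graph is. *)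
Definition definable_term (b : bool) (k : nat) (t : ctx k -> U) : Prop :=
  definable b (fun c : ctx k.+1 => ctop c = t (cpop c)).

Definition up_ren (s : nat -> nat) (n : nat) : nat :=
  if n is m.+1 then (s m).+1 else 0%N.

Fixpoint rename (s : nat -> nat) (f : formula) : formula :=
  match f with
  | fMem i j => fMem (s i) (s j)
  | fEq i j => fEq (s i) (s j)
  | fStd i => fStd (s i)
  | fFalse => fFalse
  | fImp g h => fImp (rename s g) (rename s h)
  | fAll g => fAll (rename (up_ren s) g)
  end.

Lemma internal_rename f s : internal f -> internal (rename s f).
Proof. by elim: f s => //= [f IHf g IHg|f IHf] s; [case; split; auto|auto]. Qed.

Lemma sat_rename f s (e e' : nat -> U) :
  (forall n, e' n = e (s n)) -> sat e (rename s f) <-> sat e' f.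
Proof.
elim: f s e e' => [i j|i j|i||f IHf g IHg|f IHf] s e e' Ee /=; rewrite ?Ee //.
  by rewrite (IHf s e e') // (IHg s e e').
by split=> H v; move/(_ v): H; apply IHf; case=> [|n] //=; rewrite Ee.
Qed.

(** No axiom asserts this, but if nothing were standard, transfer of falsity would have no case to
    check. It provides the parameters of formulas that use none. *)
Lemma ex_standard : exists u : U, standard u.
Proof.
apply: contrapT => N; case: (obj_inhabited U) => u0.
apply: (ist_transfer U HU fFalse (fun=> u0) _ _ _ u0) => //= u su.
by case: N; exists u.
Qed.

Section Rules.
Variable b : bool.

Definition renaming k m (g : ctx k -> ctx m) : Prop :=
  exists s, forall c (p : nat -> U) n, env (g c) p n = env c p (s n).

Definition variable k (v : ctx k -> U) : Prop :=
  exists i, forall c (p : nat -> U), v c = env c p i.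

Lemma renaming_id k : renaming (fun c : ctx k => c).
Proof. by exists id. Qed.

Lemma renaming_snd k m (g : ctx k -> ctx m.+1) :
  renaming g -> renaming (fun c => cpop (g c)).
Proof. by case=> s sP; exists (fun n => s n.+1) => c p n; rewrite -sP. Qed.

Lemma renaming_pair k m (g : ctx k -> ctx m) v :
  variable v -> renaming g -> renaming (fun c => cpush (v c) (g c)).
Proof.
move=> [i iP] [s sP]; exists (fun n => if n is n'.+1 then s n' else i) => c p.
by case=> [|n] /=; [exact: iP|exact: sP].
Qed.

Lemma variable_fst k m (g : ctx k -> ctx m.+1) :
  renaming g -> variable (fun c => ctop (g c)).
Proof. by case=> s sP; exists (s 0%N) => c p; rewrite -sP. Qed.

Lemma definable_ext k (P Q : ctx k -> Prop) :
  (forall c, P c <-> Q c) -> definable b P -> definable b Q.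
Proof.
move=> PQ [f [p [fi ps fP]]]; exists f, p; split=> // c; rewrite fP; exact: PQ.
Qed.

Lemma definable_renaming k m (g : ctx k -> ctx m) (P : ctx m -> Prop) :
  renaming g -> definable b P -> definable b (fun c => P (g c)).
Proof.
move=> [s sP] [f [p [fi ps fP]]]; exists (rename s f), p.
split=> //; first exact: internal_rename.
by move=> c; rewrite -fP; apply: sat_rename => n; rewrite sP.
Qed.

Lemma renaming_under k :
  renaming (fun c : ctx k.+2 => cpush (ctop c) (cpop (cpop c))).
Proof.
apply: (@renaming_pair k.+2 k (fun c => cpop (cpop c)) (fun c => ctop c)).
  exact/(variable_fst (g := id))/renaming_id.
exact/(renaming_snd (g := fun c : ctx k.+2 => cpop c))/(renaming_snd (g := id))/renaming_id.
Qed.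

Lemma definable_under k (P : ctx k.+1 -> Prop) :
  definable b P -> definable b (fun c : ctx k.+2 => P (cpush (ctop c) (cpop (cpop c)))).
Proof. exact/definable_renaming/renaming_under. Qed.

(** In the merged parameter sequence [p] sits at the even positions and [q] at the odd ones; the
    first [k] indices belong to the context and stay put. *)
Lemma env_interleave k (c : ctx k) (p q : nat -> U) (a : bool) n :
  env c (if a then q else p) n =
  env c (fun i => if odd i then q i./2 else p i./2)
      (if n < k then n else k + ((n - k).*2 + a))%N.
Proof.
elim: k c n => [|k IH] /= c n.
  by rewrite add0n subn0 addnC oddD odd_double addbF half_bit_double; case: a.
case: n => [|n] //=; rewrite IH ltnS subSS; case: ltnP => // _.
Qed.

(** A binary connective needs both subformulas over one common parameter sequence. *)
Lemma definable2 k m (P : ctx k -> Prop) (Q : ctx m -> Prop) :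
  definable b P -> definable b Q ->
  exists f g p, [/\ internal f /\ internal g, forall n, b -> standard (p n : U),
    forall c, sat (env c p) f <-> P c & forall c, sat (env c p) g <-> Q c].
Proof.
move=> [f [p [fi ps fP]]] [g [q [gi qs gQ]]].
pose s (k : nat) (a : bool) (n : nat) :=
  (if n < k then n else k + ((n - k).*2 + a))%N.
exists (rename (s k false) f), (rename (s m true) g).
exists (fun i => if odd i then q i./2 else p i./2); split.
- by split; exact: internal_rename.
- by move=> n bT; case: ifP => _; auto.
- by move=> c; rewrite -fP; apply: sat_rename => n; rewrite (env_interleave c p q false).
- by move=> c; rewrite -gQ; apply: sat_rename => n; rewrite (env_interleave c p q true).
Qed.

Lemma definable_pure k (P : ctx k -> Prop) f :
  internal f -> (forall c p, sat (env c p) f <-> P c) -> definable b P.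
Proof.
by move=> fi fP; case: ex_standard => u su; exists f, (fun=> u); split.
Qed.

Lemma definable_False k : definable b (fun _ : ctx k => False).
Proof. by apply: (@definable_pure _ _ fFalse). Qed.

Lemma definable_imp k (P Q : ctx k -> Prop) :
  definable b P -> definable b Q -> definable b (fun c => P c -> Q c).
Proof.
move=> dP /(definable2 dP) [f [g [p [[fi gi] ps fP gQ]]]].
by exists (fImp f g), p; split=> //= c; rewrite fP gQ.
Qed.

Lemma definable_all k (P : ctx k -> U -> Prop) :
  definable b (fun c : ctx k.+1 => P (cpop c) (ctop c)) ->
  definable b (fun c => forall u, P c u).
Proof.
move=> [f [p [fi ps fP]]]; exists (fAll f), p; split=> //= c.
by split=> H u; move/(_ u): H; rewrite (fP (u, c)).
Qed.

Lemma definable_not k (P : ctx k -> Prop) :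
  definable b P -> definable b (fun c => ~ P c).
Proof. by move=> dP; apply: definable_imp dP (definable_False k). Qed.

(** Formulas have only implication, falsity and universal quantification; the other connectives come
    from classical equivalences. *)
Lemma definable_and k (P Q : ctx k -> Prop) :
  definable b P -> definable b Q -> definable b (fun c => P c /\ Q c).
Proof.
move=> dP dQ; apply: definable_ext (definable_not (definable_imp dP (definable_not dQ))).
by move=> c; split=> [/not_implyP[p /contrapT q]|[p q] H] //; apply: H.
Qed.

Lemma definable_or k (P Q : ctx k -> Prop) :
  definable b P -> definable b Q -> definable b (fun c => P c \/ Q c).
Proof.
move=> dP dQ; apply: definable_ext (definable_imp (definable_not dP) dQ).
by move=> c; split=> [H|[]//]; case: (pselect (P c)); [left|right; apply: H].
Qed.

Lemma definable_iff k (P Q : ctx k -> Prop) :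
  definable b P -> definable b Q -> definable b (fun c => P c <-> Q c).
Proof. by move=> dP dQ; apply: definable_and; apply: definable_imp. Qed.

Lemma definable_ex k (P : ctx k -> U -> Prop) :
  definable b (fun c : ctx k.+1 => P (cpop c) (ctop c)) ->
  definable b (fun c => exists u, P c u).
Proof.
move=> dP; apply: definable_ext
  (definable_not (definable_all (P := fun c u => ~ P c u) (definable_not dP))).
by move=> c; split=> [/existsNP[u /contrapT ?]|[u Pu] /(_ u)] //; exists u.
Qed.

Lemma definable_term_var k (v : ctx k -> U) : variable v -> definable_term b v.
Proof.
move=> [i iP]; apply: (definable_pure (f := fEq 0 i.+1)) => //= c p.
by rewrite -iP.
Qed.

Lemma definable_term_const k (u : U) :
  (b -> standard u) -> definable_term b (fun _ : ctx k => u).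
Proof.
move=> su; exists (fEq 0 k.+1), (fun=> u); split=> //= c; case: c => v c /=.
suff -> : env c (fun=> u) k = u by split.
by elim: k c => [//|k IH] c; exact: IH.
Qed.

(** Terms enter an atomic formula through bound variables equated to them. The two uses of [R] are
    membership and equality. *)
Lemma definable_subst2 (R : U -> U -> Prop) f k (s t : ctx k -> U) :
  internal f -> (forall u v p, sat (push v (push u p)) f <-> R u v) ->
  definable_term b s -> definable_term b t -> definable b (fun c => R (s c) (t c)).
Proof.
move=> fi fR ds dt.
have dR : definable b (fun c => exists u, u = s c /\ exists v, v = t c /\ R u v).
  apply: definable_ex; apply: definable_and => //; apply: definable_ex.
  apply: definable_and; last by apply: (definable_pure fi) => -[v [u c]] p /=.
  exact: definable_under dt.
apply: definable_ext dR => c; split=> [[u [-> [v [->]]]]//|Rst].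
by exists (s c); split=> //; exists (t c).
Qed.

Lemma definable_mem k (s t : ctx k -> U) :
  definable_term b s -> definable_term b t -> definable b (fun c => s c ∈ t c).
Proof. by apply: (definable_subst2 (f := fMem 1 0)). Qed.

Lemma definable_eq k (s t : ctx k -> U) :
  definable_term b s -> definable_term b t -> definable b (fun c => s c = t c).
Proof. by apply: (definable_subst2 (R := eq) (f := fEq 1 0)). Qed.

Lemma definable_term_renaming k m (g : ctx k -> ctx m) (t : ctx m -> U) :
  renaming g -> definable_term b t -> definable_term b (fun c => t (g c)).
Proof.
move=> rg; apply: (definable_renaming (g := fun c : ctx k.+1 => cpush (ctop c) (g (cpop c)))).
apply: (@renaming_pair k.+1 m (fun c => g (cpop c)) (fun c => ctop c)).
  exact: (variable_fst (renaming_id _)).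
case: rg => r rP; exists (fun n => (r n).+1) => c p n; exact: rP.
Qed.

Lemma renaming_nil k : renaming (fun _ : ctx k => (tt : ctx 0)).
Proof. by exists (addn k) => c p n; elim: k c => //= k IH [u c]; exact: IH. Qed.

Lemma definable_term_subst k (h : U -> U) (v : ctx k -> U) :
  definable_term b (fun c : ctx 1 => h (ctop c)) -> definable_term b v ->
  definable_term b (fun c => h (v c)).
Proof.
move=> dh dv.
have d : definable b (fun c : ctx k.+1 => exists u, u = v (cpop c) /\ ctop c = h u).
  apply: (@definable_ex k.+1 (fun c u => u = v (cpop c) /\ ctop c = h u)).
  apply: definable_and; first exact: definable_under dv.
  apply: (definable_renaming (g := fun c : ctx k.+2 =>
    cpush (ctop (cpop c)) (cpush (ctop c) (tt : ctx 0)))) dh.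
  apply: renaming_pair; first exact/variable_fst/renaming_snd/renaming_id.
  apply: (@renaming_pair k.+2 0 (fun=> tt) (fun c => ctop c)); last exact: renaming_nil.
  exact: (variable_fst (renaming_id _)).
by apply: definable_ext d => c; split=> [[u [->]]//|->]; exists (v (cpop c)).
Qed.

Lemma definable_weak k (P : ctx k -> Prop) :
  definable b P -> definable b (fun c : ctx k.+1 => P (cpop c)).
Proof. exact/definable_renaming/renaming_snd/renaming_id. Qed.

Lemma definable_term_weak k (t : ctx k -> U) :
  definable_term b t -> definable_term b (fun c : ctx k.+1 => t (cpop c)).
Proof.
exact: definable_under.
Qed.

End Rules.

(** * The description operator [the] and its definability *)

Lemma ex_empty : exists z : U, forall w, ~ w ∈ z.
Proof. by case: (zfc_infinity U (ist_zfc U HU)) => W [[z [_ zP]] _]; exists z. Qed.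

Lemma ext_eq (A B : U) : (forall w, w ∈ A <-> w ∈ B) -> A = B.
Proof. exact: zfc_extensionality U (ist_zfc U HU) A B. Qed.

Lemma the_spec (P : U -> Prop) :
  unique P (the P) \/ (~ (exists! y, P y)) /\ forall w, ~ w ∈ the P.
Proof.
apply: (epsilon_spec (obj_inhabited U)
  (fun z => unique P z \/ ~ (exists! y, P y) /\ forall w, ~ w ∈ z)).
case: (pselect (exists! y, P y)) => [[z zP]|N]; first by exists z; left.
by case: ex_empty => z zP; exists z; right.
Qed.

Lemma the_ex (P : U -> Prop) : (exists! y, P y) -> P (the P).
Proof. by move=> E; case: (the_spec P) => [[]|[/(_ E)]]. Qed.

Lemma the_eq (P : U -> Prop) z : P z -> (forall w, P w -> w = z) -> the P = z.
Proof.
by move=> Pz Pu; apply: (Pu); apply: the_ex; exists z; split=> // w /Pu.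
Qed.

(** The default value of [the] is the empty set, which is unique by extensionality. So the graph of
    a description is first-order even where the description fails, and every term built on [the] is
    definable without side conditions. *)
Lemma eq_theE (P : U -> Prop) v :
  v = the P <-> unique P v \/ (~ (exists! y, P y)) /\ forall w, ~ w ∈ v.
Proof.
split=> [->|[[Pv Pu]|[N v0]]]; first exact: the_spec.
  by apply/esym; apply: the_eq => // w /Pu.
case: (the_spec P) => [[Pt Pu]|[_ t0]]; first by case: N; exists (the P).
by apply: ext_eq => w; split=> [/v0|/t0].
Qed.

Lemma definable_unique b k (P : ctx k -> U -> Prop) (t : ctx k -> U) :
  definable b (fun c : ctx k.+1 => P (cpop c) (ctop c)) -> definable b (fun c => P c (t c)) ->
  definable_term b t -> definable b (fun c => unique (P c) (t c)).
Proof.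
move=> dP dPt dt; apply: definable_and => //; apply: definable_all.
by apply: definable_imp => //; apply: definable_eq;
  [exact: definable_term_weak|apply: definable_term_var; exact: (variable_fst (renaming_id _))].
Qed.

Lemma definable_exu b k (P : ctx k -> U -> Prop) :
  definable b (fun c : ctx k.+1 => P (cpop c) (ctop c)) ->
  definable b (fun c => exists! u, P c u).
Proof.
move=> dP; apply: definable_ex.
apply: (@definable_unique b k.+1 (fun c => P (cpop c)) (fun c => ctop c)) => //.
  exact: definable_under dP.
apply: definable_term_var; exact: (variable_fst (renaming_id _)).
Qed.

Lemma definable_term_the b k (P : ctx k -> U -> Prop) :
  definable b (fun c : ctx k.+1 => P (cpop c) (ctop c)) -> definable_term b (fun c => the (P c)).
Proof.
have E (c : ctx k.+1) : unique (P (cpop c)) (ctop c) \/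
    (~ (exists! y, P (cpop c) y)) /\ (forall w, ~ w ∈ ctop c) <-> ctop c = the (P (cpop c)).
  by apply: iff_sym; exact: eq_theE.
move=> dP; apply: (definable_ext E).
have dv : definable_term b (fun c : ctx k.+1 => ctop c).
  apply: definable_term_var; exact: (variable_fst (renaming_id _)).
apply: definable_or; last apply: definable_and.
- apply: (@definable_unique b k.+1 (fun c => P (cpop c)) (fun c => ctop c)) => //.
  exact: definable_under dP.
- exact: definable_weak (definable_not (definable_exu dP)).
- apply: (@definable_all b k.+1 (fun c w => ~ w ∈ ctop c)).
  apply: definable_not; apply: definable_mem.
    apply: definable_term_var; exact: (variable_fst (renaming_id _)).
  apply: definable_term_var; exact: (variable_fst (renaming_snd (renaming_id _))).
Qed.

End Definability.
Arguments ctx {U} k.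

(** * Tactics proving definability *)

Ltac renaming_tac := repeat lazymatch goal with
  | |- renaming (fun c => cpop (@?g c)) => refine (renaming_snd (g := g) _)
  | |- renaming (@cpop _ _) => apply (@renaming_snd _ _ _ (fun c => c))
  | |- renaming (fun c => c) => apply renaming_id
  end.

Ltac variable_tac := lazymatch goal with
  | |- variable (@ctop _ _) => apply (@variable_fst _ _ _ (fun c => c)); apply renaming_id
  | |- variable (fun c => ctop (@?g c)) => refine (variable_fst (g := g) _); renaming_tac
  end.

Ltac standard_tac := first [assumption | by []].

(** Moves a hypothesis about an abstract predicate or term to the context at hand; in the last case
    a definable function of one variable receives an arbitrary definable argument. *)
Ltac definable_hyp := match goal with
  | |- _ => assumption
  | H : definable_term ?b ?t |- definable_term ?b (fun c => ?t (@?g c)) =>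
      refine (definable_term_renaming (g := g) _ H); renaming_tac
  | H : definable ?b ?P |- definable ?b (fun c => ?P (@?g c)) =>
      refine (definable_renaming (g := g) _ H); renaming_tac
  | H : definable_term ?b (fun c => ?t (cpop c) (ctop c))
    |- definable_term ?b (fun c => ?t (@?g c) (@?v c)) =>
      refine (definable_term_renaming (g := fun c => cpush (v c) (g c)) _ H);
      apply renaming_pair; [variable_tac | renaming_tac]
  | H : definable ?b (fun c => ?P (cpop c) (ctop c))
    |- definable ?b (fun c => ?P (@?g c) (@?v c)) =>
      refine (definable_renaming (g := fun c => cpush (v c) (g c)) _ H);
      apply renaming_pair; [variable_tac | renaming_tac]
  | H : @definable_term _ ?b 1 (fun c => ?t (ctop c)) |- definable_term ?b (fun c => ?t (@?v c)) =>
      refine (definable_term_subst (h := t) (v := v) H _)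
  end.

Ltac definable_term_leaf := lazymatch goal with
  | |- definable_term _ (@ctop _ _) =>
      apply definable_term_var; variable_tac
  | |- definable_term _ (fun c => ctop _) => apply definable_term_var; variable_tac
  | |- definable_term _ (fun _ => _) =>
      apply definable_term_const; solve [by [] | by move=> _; standard_tac]
  end.

(* Redefined below as rules for new constants become available. *)
Ltac definable_rule := fail.

Ltac definable_step := cbv beta; lazymatch goal with
  | |- definable _ (fun c => False) => apply definable_False
  | |- definable _ (fun c => ~ _) => refine (definable_not _)
  | |- definable _ (fun c => _ /\ _) => refine (definable_and _ _)
  | |- definable _ (fun c => _ \/ _) => refine (definable_or _ _)
  | |- definable _ (fun c => _ <-> _) => refine (definable_iff _ _)
  | |- definable _ (fun c => exists! u, @?P c u) => refine (definable_exu (P := P) _)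
  | |- definable _ (fun c => exists u : obj _, @?P c u) => refine (definable_ex (P := P) _)
  | |- definable _ (fun c => mem _ _) => refine (definable_mem _ _)
  | |- definable _ (fun c => @eq (obj _) _ _) => refine (definable_eq _ _)
  | |- definable _ (fun c => @?P c -> @?Q c) => refine (definable_imp (P := P) (Q := Q) _ _)
  | |- definable _ (fun c => forall u : obj _, @?P c u) => refine (definable_all (P := P) _)
  | |- definable _ _ => first [definable_hyp | definable_rule]
  | |- definable_term _ (fun c => the (@?P c)) => refine (definable_term_the (P := P) _)
  | |- definable_term _ _ => first [definable_term_leaf | definable_hyp | definable_rule]
  end.

Ltac definable_tac := repeat definable_step.

(** * The axioms of the model, restated for definable predicates *)

Section SetTheory.
Variable U : ist_model.
Local Notation HU := (ist_axioms U).
Implicit Types (A B a b p w : U).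

Lemma transfer (P : U -> Prop) : definable true (fun c : ctx 1 => P (ctop c)) ->
  (forall u, standard u -> P u) -> forall u, P u.
Proof.
move=> [f [p [fi ps fP]]] sP u; rewrite -(fP (u, tt)) /=.
apply: (ist_transfer U HU f p fi) => [n _|v sv]; first exact: ps.
by rewrite (fP (v, tt)); exact: sP.
Qed.

Lemma transfer_ex (P : U -> Prop) : definable true (fun c : ctx 1 => P (ctop c)) ->
  (exists u, P u) -> exists u, standard u /\ P u.
Proof.
move=> dP [u Pu]; apply: contrapT => N.
apply: (@transfer (fun v => ~ P v) (definable_not dP) _ u) => // v sv Pv.
by apply: N; exists v.
Qed.

(** Transfer applied to [u = t]: an object singled out by a formula with standard parameters is
    standard. *)
Lemma standard_term (t : U) : definable_term true (fun _ : ctx 0 => t) -> standard t.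
Proof.
move=> dt; have [v [sv <-]//] : exists u, standard u /\ u = t.
by apply: transfer_ex; [exact: dt|exists t].
Qed.

Lemma separation (P : U -> Prop) A : definable false (fun c : ctx 1 => P (ctop c)) ->
  exists B, forall w, w ∈ B <-> w ∈ A /\ P w.
Proof.
move=> [f [p [fi _ fP]]].
have [B BP] := zfc_separation U (ist_zfc U HU) f p A fi.
by exists B => w; rewrite BP (fP (w, tt)).
Qed.

Lemma replacement (g : U -> U) A : definable_term false (fun c : ctx 1 => g (ctop c)) ->
  exists B, forall w, w ∈ B <-> exists a, a ∈ A /\ w = g a.
Proof.
move=> [f [p [fi _ fP]]].
have E a : exists! b, sat (push b (push a p)) f.
  exists (g a); split=> [|b]; first by apply/(fP (g a, (a, tt))).
  by move=> /(fP (b, (a, tt))).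
have [B BP] := zfc_replacement U (ist_zfc U HU) f p A fi (fun a _ => E a).
by exists B => w; rewrite BP; split=> -[a [aA h]]; exists a; split=> //;
   apply/(fP (w, (a, tt))).
Qed.

(** Only internal predicates are standardized here, but their parameters may be nonstandard; this is
    what standard parts require. *)
Lemma standardization (P : U -> Prop) A : definable false (fun c : ctx 1 => P (ctop c)) ->
  standard A ->
  exists B, standard B /\ forall w, standard w -> w ∈ B <-> w ∈ A /\ P w.
Proof.
move=> [f [p [_ _ fP]]] sA.
have [B [sB BP]] := ist_standardization U HU f p A sA.
by exists B; split=> // w sw; rewrite BP // (fP (w, tt)).
Qed.

Lemma in_setof (P : U -> Prop) : (exists B, forall w, w ∈ B <-> P w) ->
  forall w, w ∈ setof P <-> P w.
Proof.
move=> [B BP]; apply: (the_ex (P := fun z => forall w, w ∈ z <-> P w)).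
by exists B; split=> // C CP; apply: ext_eq => w; rewrite BP CP.
Qed.

Lemma in_setof_sub (P : U -> Prop) A : definable false (fun c : ctx 1 => P (ctop c)) ->
  (forall w, P w -> w ∈ A) -> forall w, w ∈ setof P <-> P w.
Proof.
move=> dP PA; apply: in_setof; have [B BP] := separation A dP.
by exists B => w; rewrite BP; split=> [[]//|Pw]; split=> //; exact: PA.
Qed.

Lemma in_upair a b w : w ∈ upair a b <-> w = a \/ w = b.
Proof. by apply: in_setof; exact: (zfc_pairing U (ist_zfc U HU)). Qed.

Lemma opair_inj a b a' b' : opair a b = opair a' b' -> a = a' /\ b = b'.
Proof.
move=> E.
have H w : (w = upair a a \/ w = upair a b) <-> (w = upair a' a' \/ w = upair a' b').
  by rewrite -!in_upair; change (w ∈ opair a b <-> w ∈ opair a' b'); rewrite E.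
have I (x y : U) : upair x x = upair y y -> x = y.
  move=> e; have : x ∈ upair x x by rewrite in_upair; left.
  by rewrite e => /in_upair[].
have J (x y z : U) : upair x x = upair y z -> x = y /\ x = z.
  move=> e; have : y ∈ upair x x by rewrite e; rewrite in_upair; left.
  have : z ∈ upair x x by rewrite e; rewrite in_upair; right.
  by move=> /in_upair[] -> /in_upair[] ->.
have aa : a = a'.
  by have [/(_ (or_introl erefl))[/I|/J[]]] := H (upair a a).
subst a'; split=> //.
have [/(_ (or_intror erefl))[e|e] _] := H (upair a b).
  have [_ ab] := J _ _ _ (esym e); subst b.
  by have [_ /(_ (or_intror erefl))[] /esym/J[_]] := H (upair a b').
have : b ∈ upair a b' by rewrite -e; rewrite in_upair; right.
move=> /in_upair[ba|//]; subst b.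
by have := J _ _ _ e; case.
Qed.

End SetTheory.

(** * Set theory in a model *)

Section SetTerms.
Variable U : ist_model.
Local Notation HU := (ist_axioms U).
Variable (b : bool) (k : nat).
Implicit Types (A B a f g s t u : @ctx U k -> U).

Lemma definable_term_setof (P : @ctx U k -> U -> Prop) :
  definable b (fun c : ctx k.+1 => P (cpop c) (ctop c)) -> definable_term b (fun c => setof (P c)).
Proof.
by move=> dP; rewrite /setof; definable_tac.
Qed.

Lemma definable_term_upair s t :
  definable_term b s -> definable_term b t -> definable_term b (fun c => upair (s c) (t c)).
Proof. by move=> ds dt; apply: definable_term_setof; definable_tac. Qed.

Lemma definable_term_opair s t :
  definable_term b s -> definable_term b t -> definable_term b (fun c => opair (s c) (t c)).
Proof. by move=> ds dt; rewrite /opair; do 2?apply: definable_term_upair. Qed.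
End SetTerms.

Ltac definable_pair_rule := lazymatch goal with
  | |- definable_term _ (fun c => upair _ _) => refine (definable_term_upair _ _)
  | |- definable_term _ (fun c => opair _ _) => refine (definable_term_opair _ _)
  | |- definable_term _ (fun c => setof (@?P c)) => refine (definable_term_setof (P := P) _)
  | |- definable _ (fun c => unique (@?P c) (@?t c)) =>
      refine (definable_unique (P := P) (t := t) _ _ _)
  end.
Ltac definable_rule ::= definable_pair_rule.

Section SetTerms2.
Variable U : ist_model.
Local Notation HU := (ist_axioms U).
Variable (b : bool) (k : nat).
Implicit Types (A B a f g s t u : @ctx U k -> U).

Lemma definable_term_ap f t :
  definable_term b f -> definable_term b t -> definable_term b (fun c => ap (f c) (t c)).
Proof. by move=> df dt; rewrite /ap; definable_tac. Qed.

Lemma definable_term_prod s t :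
  definable_term b s -> definable_term b t -> definable_term b (fun c => prod (s c) (t c)).
Proof. by move=> df dt; rewrite /prod; definable_tac. Qed.

Lemma definable_subset s t :
  definable_term b s -> definable_term b t -> definable b (fun c => subset (s c) (t c)).
Proof. by move=> df dt; rewrite /subset; definable_tac. Qed.

Lemma definable_is_fun f s t :
  definable_term b f -> definable_term b s -> definable_term b t ->
  definable b (fun c => is_fun (f c) (s c) (t c)).
Proof. by move=> df ds dt; rewrite /is_fun; definable_tac. Qed.

Lemma definable_term_lam (A : @ctx U k -> U) (g : @ctx U k -> U -> U) :
  definable_term b A -> definable_term b (fun c : ctx k.+1 => g (cpop c) (ctop c)) ->
  definable_term b (fun c => lam (A c) (g c)).
Proof.
by move=> dA dg; rewrite /lam; definable_tac.
Qed.
End SetTerms2.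

Ltac definable_function_rule := lazymatch goal with
  | |- definable_term _ (fun c => ap _ _) => refine (definable_term_ap _ _)
  | |- definable_term _ (fun c => prod _ _) => refine (definable_term_prod _ _)
  | |- definable_term _ (fun c => lam (@?A c) (@?g c)) =>
      refine (definable_term_lam (A := A) (g := g) _ _)
  | |- definable _ (fun c => subset _ _) => refine (definable_subset _ _)
  | |- definable _ (fun c => is_fun _ _ _) => refine (definable_is_fun _ _ _)
  end.
Ltac definable_rule ::= first [definable_pair_rule | definable_function_rule].

Section SetTerms3.
Variable U : ist_model.
Local Notation HU := (ist_axioms U).

Lemma definable_term_funs b k (s t : @ctx U k -> U) :
  definable_term b s -> definable_term b t -> definable_term b (fun c => funs (s c) (t c)).
Proof. by move=> df dt; rewrite /funs; definable_tac. Qed.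

Implicit Types (A B f g z w m n : U).

(** Kuratowski pairs over [A] and [B] lie in the double power set of the union, from which
    separation carves the product. *)
Lemma mem_prod A B p : p ∈ prod A B <-> exists a b, a ∈ A /\ b ∈ B /\ p = opair a b.
Proof.
apply: in_setof.
have [C CP] := zfc_union U (ist_zfc U HU) (upair A B).
have [P1 P1P] := zfc_powerset U (ist_zfc U HU) C.
have [P2 P2P] := zfc_powerset U (ist_zfc U HU) P1.
have [|D DP] := @separation U
  (fun p => exists a b, a ∈ A /\ b ∈ B /\ p = opair a b) P2; first by definable_tac.
exists D => q; rewrite DP; split=> [[]//|H]; split=> //.
case: H => a [b [aA [bB ->]]]; apply/P2P => w /in_upair[]->; apply/P1P => z /in_upair[]->;
  apply/CP; by [exists A; split; [rewrite in_upair; left|]|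
                exists B; split; [rewrite in_upair; right|]].
Qed.

Lemma in_prod A B u v : opair u v ∈ prod A B <-> u ∈ A /\ v ∈ B.
Proof.
rewrite mem_prod; split=> [[a [b [aA [bB /opair_inj[-> ->]]]]]|[uA vB]] //.
by exists u, v.
Qed.

Lemma fun_ap f A B a : is_fun f A B -> a ∈ A -> ap f a ∈ B /\ opair a (ap f a) ∈ f.
Proof.
move=> [fAB fu] aA; have H : opair a (ap f a) ∈ f := the_ex (fu a aA); split=> //.
by have [a' [b' [_ [b'B /opair_inj[_ ->]]]]] := fAB _ H.
Qed.

Lemma ap_eq f A B a b : is_fun f A B -> opair a b ∈ f -> a ∈ A /\ ap f a = b.
Proof.
move=> [fAB fu] ab; have [a' [b' [aA [b'B /opair_inj[aa _]]]]] := fAB _ ab.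
subst a'; split=> //; have [b0 [_ b0u]] := fu a aA.
by apply: the_eq => // w /b0u <-; exact: b0u.
Qed.

Lemma fun_ext f g A B : is_fun f A B -> is_fun g A B ->
  (forall a, a ∈ A -> ap f a = ap g a) -> f = g.
Proof.
suff H f' g' : is_fun f' A B -> is_fun g' A B -> (forall a, a ∈ A -> ap f' a = ap g' a) ->
    subset f' g'.
  by move=> ff gf E; apply: ext_eq => w; split; apply: H => // a /E.
move=> ff gf E w wf; have [a [b [aA [_ W]]]] := proj1 ff w wf; subst w.
have [_ <-] := ap_eq ff wf; rewrite E //; exact: (proj2 (fun_ap gf aA)).
Qed.

Lemma in_funs A B f : f ∈ funs A B <-> is_fun f A B.
Proof.
have [P PP] := zfc_powerset U (ist_zfc U HU) (prod A B).
apply: (@in_setof_sub _ (fun f => is_fun f A B) P); first by definable_tac.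
move=> g [gAB _]; apply/PP => p /gAB[a [b [aA [bB ->]]]]; exact/in_prod.
Qed.

Lemma in_lam A (g : U -> U) p : definable_term false (fun c : ctx 1 => g (ctop c)) ->
  p ∈ lam A g <-> exists a, a ∈ A /\ p = opair a (g a).
Proof.
move=> dg; apply: (@in_setof _ (fun p => exists a, a ∈ A /\ p = opair a (g a))).
by apply: replacement; definable_tac.
Qed.

Lemma ap_lam A (g : U -> U) a : definable_term false (fun c : ctx 1 => g (ctop c)) ->
  a ∈ A -> ap (lam A g) a = g a.
Proof.
move=> dg aA; apply: the_eq => [|b]; rewrite in_lam //; first by exists a.
by case=> a' [_ /opair_inj[-> ->]].
Qed.

Lemma is_fun_lam A B (g : U -> U) : definable_term false (fun c : ctx 1 => g (ctop c)) ->
  (forall a, a ∈ A -> g a ∈ B) -> is_fun (lam A g) A B.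
Proof.
move=> dg gB; split=> [p|a aA].
  by rewrite in_lam // => -[a [aA ->]]; exists a, (g a); auto.
exists (g a); split=> [|b]; rewrite in_lam //; first by exists a.
by case=> a' [_ /opair_inj[-> ->]].
Qed.

Lemma in_omega n : n ∈ omega <-> forall W, inductive_set W -> n ∈ W.
Proof.
have [W0 W0i] := zfc_infinity U (ist_zfc U HU).
apply: (@in_setof_sub _ (fun n => forall W, inductive_set W -> n ∈ W) W0).
  by rewrite /inductive_set; definable_tac.
by move=> m; apply.
Qed.

Lemma omega_inductive : inductive_set (omega : U).
Proof.
have [W0 W0i] := zfc_infinity U (ist_zfc U HU); split.
  have [[z [_ z0]] _] := W0i; exists z; split=> //; apply/in_omega => W [[z' [z'W z'0]] _].
  by have -> : z = z' by apply: ext_eq => w; split=> [/z0|/z'0].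
move=> n /in_omega nW; have [_ /(_ n (nW _ W0i))[m [_ mE]]] := W0i.
exists m; split=> //; apply/in_omega => W Wi; have [_ /(_ n (nW _ Wi))[m' [m'W m'E]]] := Wi.
by have -> : m = m' by apply: ext_eq => w; rewrite mE m'E.
Qed.

(** Induction inside the model is separation from [omega], hence limited to definable predicates; in
    exchange it reaches nonstandard natural numbers. *)
Lemma omega_ind (P : U -> Prop) : definable false (fun c : ctx 1 => P (ctop c)) ->
  (forall z, (forall w, ~ w ∈ z) -> P z) ->
  (forall n m, P n -> (forall w, w ∈ m <-> w ∈ n \/ w = n) -> P m) ->
  forall n, n ∈ omega -> P n.
Proof.
move=> dP P0 PS n nO; have [W WP] := separation omega dP.
have [[z [zO z0]] oS] := omega_inductive.
suff : n ∈ W by rewrite WP => -[].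
move/in_omega: nO; apply; split; first by exists z; split=> //; rewrite WP; split=> //; exact: P0.
move=> k; rewrite WP => -[/oS[m [mO mE]] Pk]; exists m; split=> //; rewrite WP; split=> //.
exact: PS mE.
Qed.

Lemma idealization (R : U -> U -> Prop) :
  definable false (fun c : ctx 2 => R (ctop c) (ctop (cpop c))) ->
  (forall A, standard A -> finite_set A -> exists x, forall y, y ∈ A -> R x y) <->
  (exists x, forall y, standard y -> R x y).
Proof.
move=> [f [p [fi _ fP]]].
have E x y : sat (push x (push y p)) f <-> R x y := fP (x, (y, tt)).
have [H1 H2] := ist_idealization U HU f p fi.
split=> [H|[x xP] A sA fA].
  have [A sA fA|x xP] := H1; last by exists x => y /xP/E.
  by have [x xP] := H A sA fA; exists x => y /xP/E.
have [|x' x'P] := H2 _ A sA fA; first by exists x => y /xP/E.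
by exists x' => y /x'P/E.
Qed.

(** A nonstandard [i] would be an element of [d] distinct from every standard object. Idealization
    would then give an element of [d] distinct from all elements of the finite standard set [d]
    itself. *)
Lemma standard_in_omega (d i : U) : d ∈ omega -> standard d -> i ∈ d -> standard i.
Proof.
move=> dO sd id; apply: contrapT => Ni.
have [|_ /(_ _ d sd)[]] := @idealization (fun x y => x ∈ d /\ x <> y).
- by definable_tac.
- by exists i => y sy; split=> // iy; apply: Ni; rewrite iy.
- have did : definable_term false (fun c : @ctx U 1 => ctop c) by definable_tac.
  exists d, (lam d (fun u => u)); split=> //; split; first exact: is_fun_lam.
  move=> b bd; exists b; split=> [|a]; rewrite in_lam //; first by exists b.
  by case=> a' [_ /opair_inj[-> ->]].
- by move=> x xP; have [xd _] := xP i id; have [] := xP x xd.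
Qed.

End SetTerms3.

Ltac definable_funs_rule := lazymatch goal with
  | |- definable_term _ (fun c => funs _ _) => refine (definable_term_funs _ _)
  end.
Ltac definable_set_rule :=
  first [definable_pair_rule | definable_function_rule | definable_funs_rule].
Ltac definable_rule ::= definable_set_rule.

(** * The real line as an ordered field *)

Structure real_model := RealModel {
  rm_model :> ist_model;
  rm_data : real_data rm_model;
  rm_axioms : is_real_line rm_model rm_data
}.
#[global] Existing Instance rm_data.

Section Real.
Variable M : real_model.
Implicit Types u v w : M.
Local Notation HK := (rm_axioms M).

(** Making the reals of the model a Rocq type lets them carry the MathComp structure of an ordered
    field, so that [ring] and [lra] apply. *)
Definition real : Type := {a : M | a ∈ RR}.
Definition real_val (a : real) : M := sval a.
Coercion real_val : real >-> obj.

Lemma real_valP (a : real) : (a : M) ∈ RR. Proof. exact: proj2_sig a. Qed.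

Lemma real_inj (a b : real) : (a : M) = b -> a = b.
Proof.
by case: a b => [a aR] [b bR] /= ab; subst b; congr exist; exact: Prop_irrelevance.
Qed.

(* Junk value: objects which are not real numbers are sent to [0]. *)
Definition real_of (u : M) : real :=
  if pselect (u ∈ RR) is left uR then exist _ u uR else exist _ 0 (real_zero _ _ HK).

Lemma real_ofK u : u ∈ RR -> (real_of u : M) = u.
Proof. by rewrite /real_of; case: pselect. Qed.

Lemma real_valK (a : real) : real_of a = a.
Proof. by apply: real_inj; rewrite real_ofK //; exact: real_valP. Qed.

Lemma radd_in u v : u ∈ RR -> v ∈ RR -> u + v ∈ RR.
Proof. by move=> uR vR; apply: (proj1 (fun_ap (real_add _ _ HK) _)); apply/in_prod. Qed.

Lemma rmul_in u v : u ∈ RR -> v ∈ RR -> u * v ∈ RR.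
Proof. by move=> uR vR; apply: (proj1 (fun_ap (real_mul _ _ HK) _)); apply/in_prod. Qed.

Lemma rle_in u v : u <= v -> u ∈ RR /\ v ∈ RR.
Proof. by move/(real_le _ _ HK)/in_prod. Qed.

Lemma radd_inj u v w : u ∈ RR -> v ∈ RR -> w ∈ RR -> u + v = u + w -> v = w.
Proof.
move=> uR vR wR E; have [u' [u'R uu']] := real_addN _ _ HK u uR.
have H z (zR : z ∈ RR) : z = u + z + u'.
  rewrite (real_addC _ _ HK u z uR zR) -(real_addA _ _ HK z u u' zR uR u'R) uu'.
  by rewrite (real_add0 _ _ HK z zR).
by rewrite (H v vR) E -(H w wR).
Qed.

Lemma ropp_spec u : u ∈ RR -> - u ∈ RR /\ u + - u = 0.
Proof.
move=> uR; apply: (@the_ex M (fun b => b ∈ RR /\ u + b = 0)).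
have [v [vR uv]] := real_addN _ _ HK u uR.
by exists v; split=> // w [wR uw]; apply: (@radd_inj u) => //; rewrite uv.
Qed.

Definition zero_real : real := exist _ 0 (real_zero _ _ HK).
Definition one_real : real := exist _ 1 (real_one _ _ HK).
Definition opp_real (a : real) : real := exist _ (- a) (proj1 (ropp_spec (real_valP a))).
Definition add_real (a b : real) : real :=
  exist _ (radd a b) (radd_in (real_valP a) (real_valP b)).
Definition mul_real (a b : real) : real :=
  exist _ (rmul a b) (rmul_in (real_valP a) (real_valP b)).

(** MathComp wants the inverse of 0 to be 0, whereas [rdiv] by 0 takes the default value of [the];
    [rdivE] therefore compares the two divisions for nonzero divisors. *)
Lemma inv_real_ex (a : real) : exists b : real,
  (a = zero_real -> b = zero_real) /\ (a <> zero_real -> mul_real b a = one_real).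
Proof.
case: (pselect (a = zero_real)) => [a0|a0]; first by exists zero_real.
have [|b [bR ab]] := real_mulV _ _ HK a (real_valP a).
  by move=> a0'; apply: a0; apply: real_inj.
exists (exist _ b bR); split=> // _; apply: real_inj => /=.
by rewrite (real_mulC _ _ HK) //; exact: real_valP.
Qed.

Definition inv_real (a : real) : real := sval (cid (inv_real_ex a)).

HB.instance Definition _ := gen_eqMixin real.
HB.instance Definition _ := gen_choiceMixin real.

Fact add_realA : associative add_real.
Proof. by move=> a b c; apply: real_inj; apply: (real_addA _ _ HK); exact: real_valP. Qed.
Fact add_realC : commutative add_real.
Proof. by move=> a b; apply: real_inj; apply: (real_addC _ _ HK); exact: real_valP. Qed.
Fact add0_real : left_id zero_real add_real.
Proof.
by move=> a; rewrite add_realC; apply: real_inj; apply: (real_add0 _ _ HK); exact: real_valP.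
Qed.
Fact addN_real : left_inverse zero_real opp_real add_real.
Proof.
move=> a; rewrite add_realC; apply: real_inj.
exact: (proj2 (ropp_spec (real_valP a))).
Qed.
HB.instance Definition _ := GRing.isZmodule.Build real add_realA add_realC add0_real addN_real.

Fact mul_realA : associative mul_real.
Proof. by move=> a b c; apply: real_inj; apply: (real_mulA _ _ HK); exact: real_valP. Qed.
Fact mul_realC : commutative mul_real.
Proof. by move=> a b; apply: real_inj; apply: (real_mulC _ _ HK); exact: real_valP. Qed.
Fact mul1_real : left_id one_real mul_real.
Proof.
by move=> a; rewrite mul_realC; apply: real_inj; apply: (real_mul1 _ _ HK); exact: real_valP.
Qed.
Fact mul_realDl : left_distributive mul_real add_real.
Proof.
move=> a b c; rewrite !(mul_realC _ c).
by apply: real_inj; apply: (real_mulD _ _ HK); exact: real_valP.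
Qed.
Fact real_one_neq0 : one_real != 0%R.
Proof.
apply/eqP => /(congr1 real_val); exact: (real_one_neq_zero _ _ HK).
Qed.
HB.instance Definition _ := GRing.Zmodule_isComNzRing.Build real
  mul_realA mul_realC mul1_real mul_realDl real_one_neq0.

Fact real_mulVf (a : real) : a != 0%R -> (inv_real a * a)%R = 1%R.
Proof.
by move/eqP; exact: (proj2 (svalP (cid (inv_real_ex a)))).
Qed.
Fact real_invr0 : inv_real 0%R = 0%R.
Proof. exact: (proj1 (svalP (cid (inv_real_ex 0%R)))). Qed.
HB.instance Definition _ := GRing.ComNzRing_isField.Build real real_mulVf real_invr0.

Definition real_leb (a b : real) : bool := `[< rle a b >].
Definition real_ltb (a b : real) : bool := (b != a) && real_leb a b.
Definition real_norm (a : real) : real := if real_leb 0%R a then a else (- a)%R.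

Lemma rle0B (a b : real) : rle 0 (real_val (b - a)%R) <-> rle a b.
Proof.
split=> [H|H].
  have := real_le_add _ _ HK _ _ a (real_valP a) H.
  change (rle (real_val (0 + a)%R) (real_val (b - a + a)%R) -> rle a b).
  by rewrite add0r subrK.
have := real_le_add _ _ HK _ _ (- a) (real_valP (- a)%R) H.
change (rle (real_val (a - a)%R) (real_val (b - a)%R) -> rle 0 (real_val (b - a)%R)).
by rewrite subrr.
Qed.

Fact real_le0_add (a b : real) : real_leb 0%R a -> real_leb 0%R b -> real_leb 0%R (a + b)%R.
Proof.
move=> /asboolP a0 /asboolP b0; apply/asboolP; apply: (real_le_trans _ _ HK) b0 _.
have := real_le_add _ _ HK _ _ b (real_valP b) a0.
change (rle (real_val (0 + b)%R) (real_val (a + b)%R) -> rle b (real_val (a + b)%R)).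
by rewrite add0r.
Qed.
Fact real_le0_mul (a b : real) : real_leb 0%R a -> real_leb 0%R b -> real_leb 0%R (a * b)%R.
Proof. by move=> /asboolP a0 /asboolP b0; apply/asboolP; exact: (real_le_mul _ _ HK). Qed.
Fact real_le0_anti (a : real) : real_leb 0%R a -> real_leb a 0%R -> a = 0%R.
Proof.
by move=> /asboolP a0 /asboolP b0; apply: real_inj; exact: (real_le_anti _ _ HK).
Qed.
Fact real_sub_ge0 (a b : real) : real_leb 0%R (b - a)%R = real_leb a b.
Proof. by apply/asboolP/asboolP => /rle0B. Qed.
Fact real_le0_total (a : real) : real_leb 0%R a || real_leb a 0%R.
Proof.
apply/orP; case: (real_le_total _ _ HK 0 a (real_zero _ _ HK) (real_valP a)) => H.
  by left; apply/asboolP.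
by right; apply/asboolP.
Qed.
Fact real_normN (a : real) : real_norm (- a)%R = real_norm a.
Proof.
rewrite /real_norm opprK -{1}[(- a)%R]add0r real_sub_ge0.
case: ifP => a0; case: ifP => a1 //; last by move: (real_le0_total a); rewrite a0 a1.
by rewrite (real_le0_anti a1 a0) oppr0.
Qed.
Fact real_ge0_norm (a : real) : real_leb 0%R a -> real_norm a = a.
Proof. by rewrite /real_norm => ->. Qed.
Fact real_lt_def (a b : real) : real_ltb a b = (b != a) && real_leb a b.
Proof. by []. Qed.
HB.instance Definition _ := Num.IntegralDomain_isLeReal.Build real
  real_le0_add real_le0_mul real_le0_anti real_sub_ge0 real_le0_total
  real_normN real_ge0_norm real_lt_def.

End Real.

Section StandardReal.
Variable M : real_model.
Local Notation S := (real_standard M (rm_data M) (rm_axioms M)).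
Lemma std_RR : standard (RR : M). Proof. by case: S. Qed.
Lemma std_zero : standard (rzero : M). Proof. by case: S => _ []. Qed.
Lemma std_one : standard (rone : M). Proof. by case: S => _ [_ []]. Qed.
Lemma std_radd : standard (radd_graph : M). Proof. by case: S => _ [_ [_ []]]. Qed.
Lemma std_rmul : standard (rmul_graph : M). Proof. by case: S => _ [_ [_ [_ []]]]. Qed.
Lemma std_rle : standard (rle_graph : M). Proof. by case: S => _ [_ [_ [_ []]]]. Qed.
End StandardReal.

Ltac standard_tac ::= first [assumption | by [] | exact: std_RR | exact: std_zero
  | exact: std_one | exact: std_radd | exact: std_rmul | exact: std_rle].

(** * Definability of the vocabulary of analysis, one layer of definitions at a time *)

Section DefinableOperations.
Variables (M : real_model) (b : bool) (k : nat).
Implicit Types (s t u v w z : @ctx M k -> M).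

Lemma definable_term_radd s t :
  definable_term b s -> definable_term b t ->
  definable_term b (fun c => radd (s c) (t c)).
Proof. by intros; rewrite /radd; definable_tac. Qed.

Lemma definable_term_rmul s t :
  definable_term b s -> definable_term b t ->
  definable_term b (fun c => rmul (s c) (t c)).
Proof. by intros; rewrite /rmul; definable_tac. Qed.

Lemma definable_rle s t :
  definable_term b s -> definable_term b t ->
  definable b (fun c => rle (s c) (t c)).
Proof. by intros; rewrite /rle; definable_tac. Qed.

End DefinableOperations.

Ltac definable_op_rule := lazymatch goal with
  | |- definable_term _ (fun c => radd _ _) => refine (definable_term_radd _ _)
  | |- definable_term _ (fun c => rmul _ _) => refine (definable_term_rmul _ _)
  | |- definable _ (fun c => rle _ _) => refine (definable_rle _ _)
  end.
Ltac definable_rule ::=   first [definable_set_rule | definable_op_rule].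

Section DefinableOrder.
Variables (M : real_model) (b : bool) (k : nat).
Implicit Types (s t u v w z : @ctx M k -> M).

Lemma definable_rlt s t :
  definable_term b s -> definable_term b t ->
  definable b (fun c => rlt (s c) (t c)).
Proof. by intros; rewrite /rlt; definable_tac. Qed.

Lemma definable_term_ropp s :
  definable_term b s ->
  definable_term b (fun c => ropp (s c)).
Proof. by intros; rewrite /ropp; definable_tac. Qed.

End DefinableOrder.

Ltac definable_order_rule := lazymatch goal with
  | |- definable _ (fun c => rlt _ _) => refine (definable_rlt _ _)
  | |- definable_term _ (fun c => ropp _) => refine (definable_term_ropp _)
  end.
Ltac definable_rule ::=   first [definable_set_rule | definable_op_rule |
    definable_order_rule].

Section DefinableIntervals.
Variables (M : real_model) (b : bool) (k : nat).
Implicit Types (s t u v w z : @ctx M k -> M).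

Lemma definable_term_rsub s t :
  definable_term b s -> definable_term b t ->
  definable_term b (fun c => rsub (s c) (t c)).
Proof. by intros; rewrite /rsub; definable_tac. Qed.

Lemma definable_term_rdiv s t :
  definable_term b s -> definable_term b t ->
  definable_term b (fun c => rdiv (s c) (t c)).
Proof. by intros; rewrite /rdiv; definable_tac. Qed.

Lemma definable_term_rabs s :
  definable_term b s ->
  definable_term b (fun c => rabs (s c)).
Proof. by intros; rewrite /rabs; definable_tac. Qed.

Lemma definable_term_Icc s t :
  definable_term b s -> definable_term b t ->
  definable_term b (fun c => Icc (s c) (t c)).
Proof. by intros; rewrite /Icc; definable_tac. Qed.

Lemma definable_term_Ico s t :
  definable_term b s -> definable_term b t ->
  definable_term b (fun c => Ico (s c) (t c)).
Proof. by intros; rewrite /Ico; definable_tac. Qed.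

Lemma definable_term_Rvec s :
  definable_term b s ->
  definable_term b (fun c => Rvec (s c)).
Proof. by intros; rewrite /Rvec; definable_tac. Qed.

Lemma definable_is_lub (P : @ctx M k -> M -> Prop) t :
  definable b (fun c : ctx k.+1 => P (cpop c) (ctop c)) -> definable_term b t ->
  definable b (fun c => is_lub (P c) (t c)).
Proof. by move=> dP dt; rewrite /is_lub; definable_tac. Qed.

Lemma definable_term_rsup (P : @ctx M k -> M -> Prop) :
  definable b (fun c : ctx k.+1 => P (cpop c) (ctop c)) ->
  definable_term b (fun c => rsup (P c)).
Proof. by move=> dP; rewrite /rsup /is_lub; definable_tac. Qed.

End DefinableIntervals.

Ltac definable_interval_rule := lazymatch goal with
  | |- definable_term _ (fun c => rsub _ _) => refine (definable_term_rsub _ _)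
  | |- definable_term _ (fun c => rdiv _ _) => refine (definable_term_rdiv _ _)
  | |- definable_term _ (fun c => rabs _) => refine (definable_term_rabs _)
  | |- definable_term _ (fun c => Icc _ _) => refine (definable_term_Icc _ _)
  | |- definable_term _ (fun c => Ico _ _) => refine (definable_term_Ico _ _)
  | |- definable_term _ (fun c => Rvec _) => refine (definable_term_Rvec _)
  | |- definable _ (fun c => is_lub (@?P c) (@?t c)) =>
      refine (definable_is_lub (P := P) (t := t) _ _)
  | |- definable_term _ (fun c => rsup (@?P c)) => refine (definable_term_rsup (P := P) _)
  end.
Ltac definable_rule ::=   first [definable_set_rule | definable_op_rule |
    definable_order_rule | definable_interval_rule].

Section DefinableVectors.
Variables (M : real_model) (b : bool) (k : nat).
Implicit Types (s t u v w z : @ctx M k -> M).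

Lemma definable_term_vsub s t u :
  definable_term b s -> definable_term b t -> definable_term b u ->
  definable_term b (fun c => vsub (s c) (t c) (u c)).
Proof. by intros; rewrite /vsub; definable_tac. Qed.

Lemma definable_term_vdiv s t u :
  definable_term b s -> definable_term b t -> definable_term b u ->
  definable_term b (fun c => vdiv (s c) (t c) (u c)).
Proof. by intros; rewrite /vdiv; definable_tac. Qed.

Lemma definable_term_vnorm s t :
  definable_term b s -> definable_term b t ->
  definable_term b (fun c => vnorm (s c) (t c)).
Proof. by intros; rewrite /vnorm; definable_tac. Qed.

Lemma definable_term_seg s t u :
  definable_term b s -> definable_term b t -> definable_term b u ->
  definable_term b (fun c => seg (s c) (t c) (u c)).
Proof. by intros; rewrite /seg; definable_tac. Qed.

Lemma definable_term_Ici s :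
  definable_term b s ->
  definable_term b (fun c => Ici (s c)).
Proof. by intros; rewrite /Ici; definable_tac. Qed.

End DefinableVectors.

Ltac definable_vector_rule := lazymatch goal with
  | |- definable_term _ (fun c => vsub _ _ _) => refine (definable_term_vsub _ _ _)
  | |- definable_term _ (fun c => vdiv _ _ _) => refine (definable_term_vdiv _ _ _)
  | |- definable_term _ (fun c => vnorm _ _) => refine (definable_term_vnorm _ _)
  | |- definable_term _ (fun c => seg _ _ _) => refine (definable_term_seg _ _ _)
  | |- definable_term _ (fun c => Ici _) => refine (definable_term_Ici _)
  end.
Ltac definable_rule ::=   first [definable_set_rule | definable_op_rule |
    definable_order_rule | definable_interval_rule | definable_vector_rule].

Section DefinableFunctions.
Variables (M : real_model) (b : bool) (k : nat).
Implicit Types (s t u v w z : @ctx M k -> M).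

Lemma definable_continuous_on s t u :
  definable_term b s -> definable_term b t -> definable_term b u ->
  definable b (fun c => continuous_on (s c) (t c) (u c)).
Proof. by intros; rewrite /continuous_on; definable_tac. Qed.

Lemma definable_term_Csub s t u v :
  definable_term b s -> definable_term b t -> definable_term b u -> definable_term b v ->
  definable_term b (fun c => Csub (s c) (t c) (u c) (v c)).
Proof. by intros; rewrite /Csub; definable_tac. Qed.

Lemma definable_term_Cnorm s t u :
  definable_term b s -> definable_term b t -> definable_term b u ->
  definable_term b (fun c => Cnorm (s c) (t c) (u c)).
Proof. by intros; rewrite /Cnorm; definable_tac. Qed.

Lemma definable_has_derivative s t u v w :
  definable_term b s -> definable_term b t -> definable_term b u -> definable_term b v
  -> definable_term b w ->
  definable b (fun c => has_derivative (s c) (t c) (u c) (v c) (w c)).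
Proof. by intros; rewrite /has_derivative; definable_tac. Qed.

Lemma definable_interval_from s t :
  definable_term b s -> definable_term b t ->
  definable b (fun c => interval_from (s c) (t c)).
Proof. by intros; rewrite /interval_from; definable_tac. Qed.

End DefinableFunctions.

Ltac definable_analysis_rule := lazymatch goal with
  | |- definable _ (fun c => continuous_on _ _ _) => refine (definable_continuous_on _ _ _)
  | |- definable_term _ (fun c => Csub _ _ _ _) => refine (definable_term_Csub _ _ _ _)
  | |- definable_term _ (fun c => Cnorm _ _ _) => refine (definable_term_Cnorm _ _ _)
  | |- definable _ (fun c => has_derivative _ _ _ _ _) =>
      refine (definable_has_derivative _ _ _ _ _)
  | |- definable _ (fun c => interval_from _ _) => refine (definable_interval_from _ _)
  end.
Ltac definable_rule ::=   first [definable_set_rule | definable_op_rule |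
    definable_order_rule | definable_interval_rule | definable_vector_rule |
    definable_analysis_rule].

Section DefinableSolutions.
Variables (M : real_model) (b : bool) (k : nat).
Implicit Types (s t u v w z : @ctx M k -> M).

Lemma definable_term_Cspace s t :
  definable_term b s -> definable_term b t ->
  definable_term b (fun c => Cspace (s c) (t c)).
Proof. by intros; rewrite /Cspace; definable_tac. Qed.

Lemma definable_solution s t u v w z :
  definable_term b s -> definable_term b t -> definable_term b u -> definable_term b v
  -> definable_term b w -> definable_term b z ->
  definable b (fun c => solution (s c) (t c) (u c) (v c) (w c) (z c)).
Proof. by intros; rewrite /solution; definable_tac. Qed.

End DefinableSolutions.

Ltac definable_solution_rule := lazymatch goal with
  | |- definable_term _ (fun c => Cspace _ _) => refine (definable_term_Cspace _ _)
  | |- definable _ (fun c => solution _ _ _ _ _ _) => refine (definable_solution _ _ _ _ _ _)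
  end.
Ltac definable_rule ::=   first [definable_set_rule | definable_op_rule |
    definable_order_rule | definable_interval_rule | definable_vector_rule |
    definable_analysis_rule | definable_solution_rule].

Section DefinableMaximal.
Variables (M : real_model) (b : bool) (k : nat).
Implicit Types (s t u v w z : @ctx M k -> M).

Lemma definable_maximal_solution s t u v w z :
  definable_term b s -> definable_term b t -> definable_term b u -> definable_term b v
  -> definable_term b w -> definable_term b z ->
  definable b (fun c => maximal_solution (s c) (t c) (u c) (v c) (w c) (z c)).
Proof. by intros; rewrite /maximal_solution; definable_tac. Qed.

End DefinableMaximal.

Ltac definable_maximal_rule := lazymatch goal with
  | |- definable _ (fun c => maximal_solution _ _ _ _ _ _) =>
      refine (definable_maximal_solution _ _ _ _ _ _)
  end.
Ltac definable_rule ::=   first [definable_set_rule | definable_op_rule |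
    definable_order_rule | definable_interval_rule | definable_vector_rule |
    definable_analysis_rule | definable_solution_rule | definable_maximal_rule].

Local Open Scope ring_scope.

(** * Translation between the notions of the model and those on [real] *)

Section RealBridge.
Variable M : real_model.
Local Notation R := (real M).
Local Notation HK := (rm_axioms M).
Implicit Types (a b c : R) (u v : M).

Lemma real_ex u : u ∈ RR -> exists a : R, u = a.
Proof. by move=> uR; exists (real_of u); rewrite real_ofK. Qed.

Lemma rleE a b : rle a b <-> a <= b.
Proof. by split=> [H|/asboolP//]; apply/asboolP. Qed.

Lemma rltE a b : rlt a b <-> a < b.
Proof.
rewrite /rlt rleE lt_def; split=> [[-> ab]|/andP[ba ->]].
  by rewrite andbT; apply/eqP => ba; apply: ab; rewrite ba.
by split=> // /real_inj ab; rewrite ab eqxx in ba.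
Qed.

Lemma rle0E a : rle rzero a <-> 0 <= a. Proof. exact: (rleE 0 a). Qed.
Lemma rlt0E a : rlt rzero a <-> 0 < a. Proof. exact: (rltE 0 a). Qed.

Lemma rabsE a : rabs a = real_val `|a|.
Proof.
apply: (@the_eq M) => [|u].
  have [a0|a0] := leP 0 a; [left|right].
    by rewrite ger0_norm //; split=> //; apply/(rleE 0 a).
  by rewrite ltr0_norm //; split=> //; apply/(rltE a 0).
rewrite (rleE 0 a) (rltE a 0).
by case=> -[a0 ->]; [rewrite ger0_norm|rewrite ltr0_norm].
Qed.

Lemma rdivE a b : b != 0 -> rdiv a b = real_val (a / b).
Proof.
move=> b0; apply: (@the_eq M) => [|u].
  split; first exact: real_valP.
  by change (real_val (a / b * b) = a); rewrite divfK.
move=> [/real_ex[c ->] E]; have {}E : c * b = a by exact: real_inj.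
by rewrite -E mulfK.
Qed.

Lemma in_Icc u v w : w ∈ Icc u v <-> w ∈ RR /\ rle u w /\ rle w v.
Proof.
by apply: (@in_setof_sub M _ RR) => [|t []//]; definable_tac.
Qed.

Lemma in_IccE a b c : (c : M) ∈ Icc a b <-> a <= c <= b.
Proof.
rewrite in_Icc !rleE; split=> [[_ [-> ->]]//|/andP[-> ->]].
by split=> //; exact: real_valP.
Qed.

Lemma in_Ico u v w : w ∈ Ico u v <-> w ∈ RR /\ rle u w /\ rlt w v.
Proof.
by apply: (@in_setof_sub M _ RR) => [|t []//]; definable_tac.
Qed.

Lemma in_IcoE a b c : (c : M) ∈ Ico a b <-> a <= c < b.
Proof.
rewrite in_Ico rleE rltE; split=> [[_ [-> ->]]//|/andP[-> ->]].
by split=> //; exact: real_valP.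
Qed.

Lemma in_Ici u w : w ∈ Ici u <-> w ∈ RR /\ rle u w.
Proof.
by apply: (@in_setof_sub M _ RR) => [|t []//]; definable_tac.
Qed.

Lemma in_IciE a b : (b : M) ∈ Ici a <-> a <= b.
Proof. by rewrite in_Ici rleE; split=> [[]|]//; split=> //; exact: real_valP. Qed.

Lemma infinitesimalE a :
  infinitesimal a <-> forall e : R, standard e -> 0 < e -> `|a| < e.
Proof.
rewrite /infinitesimal rabsE; split=> H e.
  by move=> se e0; apply/rltE/H => //; [exact: real_valP|apply/rlt0E].
by move=> /real_ex[{}e ->] se /rlt0E e0; apply/rltE/H.
Qed.

Lemma limitedE a : limited a <-> exists2 e : R, standard e & 0 < e /\ `|a| <= e.
Proof.
rewrite /limited rabsE; split=> [[e [/real_ex[{}e ->] [se [/rlt0E e0 /rleE ae]]]]|].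
  by exists e.
case=> e se [e0 ae]; exists e; split; first exact: real_valP.
by split=> //; split; [apply/rlt0E|apply/rleE].
Qed.

End RealBridge.

(** * Definability of statements over the type [real] *)

Section DefinableRealTerms.
Variables (M : real_model) (d : bool) (k : nat).
Local Notation R := (real M).
Implicit Types (a b : @ctx M k -> R).

(** Variables of formulas range over all objects, so a quantifier over [real] becomes one bounded by
    [RR], and the body reads its variable through [real_of]. *)
Lemma definable_all_real (P : @ctx M k -> R -> Prop) :
  definable d (fun c : ctx k.+1 => P (cpop c) (real_of (ctop c))) ->
  definable d (fun c => forall a : R, P c a).
Proof.
move=> dP; have dQ : definable d (fun c : @ctx M k => forall u : M, u ∈ RR -> P c (real_of u)).
  by definable_tac.
apply: definable_ext dQ => c; split=> H.
  by move=> a; rewrite -(real_valK a); apply: H; exact: real_valP.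
by move=> u _; apply: H.
Qed.

Lemma definable_ex_real (P : @ctx M k -> R -> Prop) :
  definable d (fun c : ctx k.+1 => P (cpop c) (real_of (ctop c))) ->
  definable d (fun c => exists a : R, P c a).
Proof.
move=> dP; have dQ : definable d (fun c : @ctx M k => exists u : M, u ∈ RR /\ P c (real_of u)).
  by definable_tac.
apply: definable_ext dQ => c; split=> [[u [_ H]]|[a H]]; first by exists (real_of u).
by exists (real_val a); rewrite real_valK; split=> //; exact: real_valP.
Qed.

Lemma definable_ex2_real (P Q : @ctx M k -> R -> Prop) :
  definable d (fun c : ctx k.+1 => P (cpop c) (real_of (ctop c))) ->
  definable d (fun c : ctx k.+1 => Q (cpop c) (real_of (ctop c))) ->
  definable d (fun c => exists2 a : R, P c a & Q c a).
Proof.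
move=> dP dQ; have dPQ : definable d (fun c => exists a : R, P c a /\ Q c a).
  by refine (definable_ex_real (P := fun c (h : R) => P c h /\ Q c h) _); exact: definable_and.
by apply: definable_ext dPQ => c; split=> [[a [Pa Qa]]|[a Pa Qa]]; exists a.
Qed.

Lemma definable_eq_real a b :
  definable_term d (fun c => real_val (a c)) -> definable_term d (fun c => real_val (b c)) ->
  definable d (fun c => a c = b c).
Proof.
move=> da db; apply: definable_ext (definable_eq da db) => c.
by split=> [/real_inj|->].
Qed.

Lemma definable_le_real a b :
  definable_term d (fun c => real_val (a c)) -> definable_term d (fun c => real_val (b c)) ->
  definable d (fun c => a c <= b c).
Proof.
by move=> da db; apply: definable_ext (definable_rle da db) => c; exact: rleE.
Qed.

Lemma definable_lt_real a b :
  definable_term d (fun c => real_val (a c)) -> definable_term d (fun c => real_val (b c)) ->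
  definable d (fun c => a c < b c).
Proof.
by move=> da db; apply: definable_ext (definable_rlt da db) => c; exact: rltE.
Qed.

Lemma definable_term_addr a b :
  definable_term d (fun c => real_val (a c)) -> definable_term d (fun c => real_val (b c)) ->
  definable_term d (fun c => real_val (a c + b c)).
Proof. exact: definable_term_radd. Qed.

Lemma definable_term_mulr a b :
  definable_term d (fun c => real_val (a c)) -> definable_term d (fun c => real_val (b c)) ->
  definable_term d (fun c => real_val (a c * b c)).
Proof. exact: definable_term_rmul. Qed.

Lemma definable_term_oppr a :
  definable_term d (fun c => real_val (a c)) ->
  definable_term d (fun c => real_val (- a c)).
Proof. exact: definable_term_ropp. Qed.

Lemma definable_term_normr a :
  definable_term d (fun c => real_val (a c)) ->
  definable_term d (fun c => real_val `|a c|).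
Proof.
move=> /definable_term_rabs; apply: definable_ext => c; by rewrite rabsE.
Qed.

Lemma definable_term_real_of (u : @ctx M k -> M) :
  definable_term d u -> definable_term d (fun c => real_val (real_of (u c))).
Proof.
move=> du; have dv : definable d (fun c : @ctx M k.+1 =>
    (u (cpop c) ∈ RR /\ ctop c = u (cpop c)) \/ (~ u (cpop c) ∈ RR /\ ctop c = rzero)).
  by definable_tac.
apply: definable_ext dv => c; rewrite /real_of; case: pselect => uR /=.
  by split=> [[[]|[]]|->]//; left.
by split=> [[[]|[]]|->]//; right.
Qed.

Lemma definable_term_invr a :
  definable_term d (fun c => real_val (a c)) ->
  definable_term d (fun c => real_val (a c)^-1).
Proof.
move=> da; pose t c := real_val (a c); have dt : definable_term d t := da.
have dv : definable d (fun c : @ctx M k.+1 => (t (cpop c) = rzero /\ ctop c = rzero) \/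
    (~ (t (cpop c) = rzero) /\ (ctop c ∈ RR /\ rmul (ctop c) (t (cpop c)) = rone))).
  by definable_tac.
apply: definable_ext dv => c; rewrite /t; set x := a (cpop c); have [x0|x0] := eqVneq x 0.
  rewrite x0 invr0; split=> [[[]|[]]|->]//; by left.
split=> [[[/(@real_inj M x 0) x0']|[_ [/real_ex[y ->] yx]]]|->].
- by rewrite x0' eqxx in x0.
- have {}yx : y * x = 1 by apply: real_inj.
  by rewrite -(mulKf x0 y) (mulrC x y) yx mulr1.
- right; split; first by move/(@real_inj M x 0)/eqP; rewrite (negPf x0).
  split; first exact: real_valP.
  by change (real_val (x^-1 * x) = real_val 1); rewrite mulVf.
Qed.

Lemma definable_andb (p q : @ctx M k -> bool) :
  definable d (fun c => p c) -> definable d (fun c => q c) -> definable d (fun c => p c && q c).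
Proof.
move=> dp dq; apply: definable_ext (definable_and dp dq) => c.
by split=> [[-> ->]|/andP[]].
Qed.
End DefinableRealTerms.

(** The induction is on a number of Rocq, so it reaches only the numerals and no nonstandard natural
    number of the model. *)
Lemma std_natr (M : real_model) n : standard (real_val (n%:R : real M)).
Proof.
elim: n => [|n IH]; first exact: std_zero.
by rewrite -addn1 natrD; apply: standard_term; apply: definable_term_addr;
  apply: definable_term_const => _ //; exact: std_one.
Qed.

Lemma std1 (M : real_model) : standard (real_val (1 : real M)). Proof. exact: std_one. Qed.

Ltac standard_tac ::= first [assumption | by [] | exact: std_RR | exact: std_zero
  | exact: std_one | exact: std_radd | exact: std_rmul | exact: std_rle | exact: std_natr].

Ltac definable_real_rule := lazymatch goal with
  | |- definable _ (fun c => forall a : real _, @?P c a) => refine (definable_all_real (P := P) _)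
  | |- definable _ (fun c => exists a : real _, @?P c a) => refine (definable_ex_real (P := P) _)
  | |- definable _ (fun c => exists2 a : real _, @?P c a & @?Q c a) =>
      refine (definable_ex2_real (P := P) (Q := Q) _ _)
  | |- definable _ (fun c => @eq (real _) _ _) => refine (definable_eq_real _ _)
  | |- definable _ (fun c => is_true (_ && _)) => refine (definable_andb _ _)
  | |- definable _ (fun c => is_true (_ <= _)) => refine (definable_le_real _ _)
  | |- definable _ (fun c => is_true (_ < _)) => refine (definable_lt_real _ _)
  | |- definable_term _ (fun c => real_val (_ + _)) => refine (definable_term_addr _ _)
  | |- definable_term _ (fun c => real_val (_ * _)) => refine (definable_term_mulr _ _)
  | |- definable_term _ (fun c => real_val (- _)) => refine (definable_term_oppr _)
  | |- definable_term _ (fun c => real_val (`|_|)) => refine (definable_term_normr _)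
  | |- definable_term _ (fun c => real_val (_^-1)) => refine (definable_term_invr _)
  | |- definable_term _ (fun c => real_val (real_of _)) => refine (definable_term_real_of _)
  end.
Ltac definable_analysis_rules :=
  first [definable_set_rule | definable_op_rule | definable_order_rule |
    definable_interval_rule | definable_vector_rule | definable_analysis_rule |
    definable_solution_rule | definable_maximal_rule].
Ltac definable_rule ::= first [definable_analysis_rules | definable_real_rule].

Ltac std_tac := apply: standard_term; definable_tac.

(** * Infinitesimals *)

Definition small (M : real_model) (a : real M) : Prop :=
  forall e : real M, standard (e : M) -> 0 < e -> `|a| < e.

(* Locked, like [fco] and [field_along] below: comparing distinct instances up to
   conversion would unfold the set-theoretic encoding of the reals. *)
HB.lock Definition near (M : real_model) (a b : real M) : Prop := small (a - b).

Lemma norm_le_dist (R : numDomainType) (a b : R) : `|a| <= `|a - b| + `|b|.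
Proof. by rewrite -{1}(subrK b a) ler_normD. Qed.

Lemma slope_le (R : numFieldType) (a p v e : R) : p != 0 ->
  (`|a / p - v| <= e) = (`|a - p * v| <= e * `|p|).
Proof.
move=> p0; have np : 0 < `|p| by rewrite normr_gt0.
by rewrite -(ler_pM2r np) -normrM mulrBl divfK // [v * p]mulrC.
Qed.

(** * Transfer, suprema, infinitesimals and spilling for reals *)

Section RealPrinciples.
Variable M : real_model.
Local Notation R := (real M).
Local Notation HK := (rm_axioms M).
Implicit Types (a b c e k : R).

Lemma real_transfer (P : R -> Prop) :
  definable true (fun c : ctx 1 => P (real_of (ctop c))) ->
  (forall a, standard a -> P a) -> forall a, P a.
Proof.
move=> dP sP a; rewrite -(real_valK a).
apply: (@transfer M (fun u => u ∈ RR -> P (real_of u))); last exact: real_valP.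
  by definable_tac.
by move=> u su uR; apply: sP; rewrite ?real_ofK.
Qed.

Lemma real_transfer_ex (P : R -> Prop) :
  definable true (fun c : ctx 1 => P (real_of (ctop c))) ->
  (exists a, P a) -> exists2 a : R, standard a & P a.
Proof.
move=> dP [a Pa]; have [||u [su [uR Pu]]] := @transfer_ex M (fun u => u ∈ RR /\ P (real_of u)).
- by definable_tac.
- by exists (real_val a); rewrite real_valK; split=> //; exact: real_valP.
- by exists (real_of u); rewrite ?real_ofK.
Qed.

(** Completeness speaks of the sets of the model, so separation must first turn the predicate into
    one. *)
Lemma real_lub (P : R -> Prop) :
  definable false (fun c : ctx 1 => P (real_of (ctop c))) ->
  (exists a, P a) -> (exists b, forall a, P a -> a <= b) ->
  exists2 s : R, (forall a, P a -> a <= s) & (forall b, (forall a, P a -> a <= b) -> s <= b).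
Proof.
move=> dP [a Pa] [b bP]; have [A AP] := @separation M (fun u => P (real_of u)) RR dP.
have AE c : (c : M) ∈ A <-> P c.
  by rewrite AP real_valK; split=> [[]//|]; split=> //; exact: real_valP.
have [||| _ [/real_ex[s ->] [s1 s2]]] := real_complete _ _ HK A.
- by move=> w /AP[].
- by exists (real_val a); apply/AE.
- exists b; split; first exact: real_valP.
  by move=> w /[dup]/AP[/real_ex[c ->] _] /AE/bP cb; apply/rleE.
exists s => [c /AE/s1/rleE//|c cP]; apply/rleE/s2; first exact: real_valP.
by move=> w /[dup]/AP[/real_ex[c' ->] _] /AE/cP cb; apply/rleE.
Qed.

Lemma lub_lt (P : R -> Prop) (s t : R) :
  (forall b, (forall a, P a -> a <= b) -> s <= b) -> t < s -> exists2 a : R, P a & t < a.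
Proof.
move=> sP ts; apply: contrapT => N; have : s <= t; last by rewrite leNgt ts.
by apply: sP => a Pa; rewrite leNgt; apply/negP => ta; apply: N; exists a.
Qed.

Lemma rsupE (P : M -> Prop) (s : R) :
  (forall a : R, P a -> a <= s) -> (forall b : R, (forall a : R, P a -> a <= b) -> s <= b) ->
  (forall u, P u -> u ∈ RR) -> rsup P = s.
Proof.
move=> s1 s2 PR; have L : is_lub P s.
  split; first exact: real_valP.
  split=> [u /[dup]/PR/real_ex[a ->] /s1 ?|u /real_ex[b ->] bP]; first exact/rleE.
  by apply/rleE/s2 => a /bP/rleE.
apply: (@the_eq M) => // u [/real_ex[t ->] [t1 t2]]; congr real_val.
apply/eqP; rewrite eq_le; apply/andP; split; apply/rleE.
  exact: (t2 s (real_valP s) (proj1 (proj2 L))).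
exact: (proj2 (proj2 L) t (real_valP t)).
Qed.

Lemma small0 : small (0 : R). Proof. by move=> e _; rewrite normr0. Qed.

Lemma small_le a b : `|a| <= `|b| -> small b -> small a.
Proof. by move=> ab bs e se e0; apply: le_lt_trans ab (bs e se e0). Qed.

Lemma smallN a : small a -> small (- a).
Proof. by apply: small_le; rewrite normrN. Qed.

(** Error terms may add up to a fixed standard multiple of [e]: it suffices to start from
    [e / k]. *)
Lemma small_scale a k : standard k -> (forall e, standard e -> 0 < e -> `|a| < k * e) -> small a.
Proof.
move=> sk H e se e0; have [k0|k0] := ltP 0 k.
  have -> : e = k * (e / k) by field; apply: lt0r_neq0.
  by apply: H; [std_tac|exact: divr_gt0].
apply: lt_le_trans (H e se e0) _; apply: le_trans (ltW e0).
by rewrite mulr_le0_ge0 // ltW.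
Qed.

Lemma smallD a b : small a -> small b -> small (a + b).
Proof.
move=> sa sb; apply: (@small_scale _ 2) => [|e se e0]; first exact: std_natr.
have := sa e se e0; have := sb e se e0; have := ler_normD a b; lra.
Qed.

Lemma smallM a k b : standard k -> `|a| <= k -> small b -> small (a * b).
Proof.
move=> sk ak sb; apply: (@small_scale _ (k + 1)) => [|e se e0]; first by std_tac.
rewrite normrM; have := sb e se e0; have := normr_ge0 a; have := normr_ge0 b; nra.
Qed.

Lemma small_standard a : standard a -> small a -> a = 0.
Proof.
move=> sa aa; apply/eqP; apply: contraT => a0.
have := aa `|a|; rewrite ltxx; apply; [by std_tac|by rewrite normr_gt0].
Qed.

Lemma small_lt a e : small a -> standard (e : M) -> 0 < e -> `|a| < e.
Proof. exact. Qed.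

Lemma nearB a b : near a b <-> small (a - b).
Proof. by rewrite near.unlock. Qed.

Lemma near_lt a b e : near a b -> standard (e : M) -> 0 < e -> `|a - b| < e.
Proof. by rewrite nearB; exact: small_lt. Qed.

Lemma near_refl a : near a a.
Proof. by rewrite nearB subrr; exact: small0. Qed.

Lemma near_sym a b : near a b -> near b a.
Proof. by rewrite !nearB => /smallN; rewrite opprB. Qed.

Lemma near_trans b a c : near a b -> near b c -> near a c.
Proof.
move=> /nearB ab /nearB bc; apply/nearB.
suff -> : a - c = (a - b) + (b - c) by exact: smallD.
by lra.
Qed.

Lemma near_standard a b : standard a -> standard b -> near a b -> a = b.
Proof. by move=> sa sb /nearB/small_standard ab; apply/subr0_eq/ab; std_tac. Qed.

(** Weak inequalities survive passing to standard parts: otherwise half of the gap [b - e] would be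
    a standard positive number bounding both distances. *)
Lemma near_le a b c e : near a b -> near c e -> a <= c -> standard b -> standard e -> b <= e.
Proof.
move=> ab ce ac sb se; rewrite leNgt; apply/negP => eb.
have h : standard (real_val ((b - e) / 2)) by std_tac.
have h0 : 0 < (b - e) / 2 by lra.
have := near_lt ab h h0; have := near_lt ce h h0; rewrite !ltr_norml; lra.
Qed.

Definition lim a := exists2 k : R, standard k & `|a| <= k.

Lemma standard_lim a : standard a -> lim a.
Proof. by exists `|a|; [std_tac|]. Qed.

Lemma near_lim a b : lim b -> near a b -> lim a.
Proof.
move=> [k sk bk] ab; exists (k + 1); first by std_tac.
have := near_lt ab (std1 M) ltr01; have := norm_le_dist a b; lra.
Qed.

(* The supremum of the [e <= 1] satisfying [P] cannot be small. *)
Lemma underspill (P : R -> Prop) (m : R) :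
  definable false (fun c : ctx 1 => P (real_of (ctop c))) ->
  0 < m -> small m ->
  (forall a b, 0 < a -> a <= b -> P b -> P a) ->
  (forall a, 0 < a -> small a -> P a) ->
  exists e : R, [/\ standard e, 0 < e & P e].
Proof.
move=> dP m0 sm Pdown Psmall.
have [||| s s1 s2] := @real_lub (fun e => e <= 1 /\ P e); first by definable_tac.
- exists m; split; last exact: Psmall.
  by have := sm 1 (std1 M) ltr01; rewrite gtr0_norm // => /ltW.
- by exists 1 => a [].
have ms : m <= s.
  apply: s1; split; last exact: Psmall.
  by have := sm 1 (std1 M) ltr01; rewrite gtr0_norm // => /ltW.
have [ss|] := pselect (small s).
  have s0 : 0 < s by lra.
  have s20 : 0 < s + s by lra.
  have : s + s <= s; last by lra.
  apply: s1; split; last by apply: Psmall => //; exact: smallD.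
  by have := smallD ss ss (std1 M) ltr01; rewrite gtr0_norm // => /ltW.
move/existsNP => [e /not_implyP[se /not_implyP[e0 /negP]]].
rewrite -leNgt gtr0_norm; last by lra.
move=> es; have [|a [_ Pa] ea] := @lub_lt (fun e => e <= 1 /\ P e) s (e / 2) s2; first by lra.
exists (e / 2); split; [by std_tac|by lra|].
by apply: Pdown Pa; lra.
Qed.

(** Underspill for [~ P]: if no positive infinitesimal satisfied [P], some standard positive number
    would violate it. *)
Lemma overspill (P : R -> Prop) (m : R) :
  definable false (fun c : ctx 1 => P (real_of (ctop c))) ->
  0 < m -> small m ->
  (forall a b, 0 < a -> a <= b -> P a -> P b) ->
  (forall e, standard e -> 0 < e -> P e) ->
  exists e : R, [/\ small e, 0 < e & P e].
Proof.
move=> dP m0 sm Pup Pstd; apply: contrapT => N.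
have [|||e [se e0]] := @underspill (fun e => ~ P e) m _ m0 sm; first by definable_tac.
- by move=> a b a0 ab nPb Pa; apply: nPb; apply: Pup Pa.
- by move=> a a0 sa Pa; apply: N; exists a.
- by apply; apply: Pstd.
Qed.

End RealPrinciples.

(** * Coordinates and norms *)

Definition co (M : real_model) (v i : M) : real M := real_of (ap v i).

HB.lock Definition fco (M : real_model) (w : M) (t : real M) (i : M) : real M :=
  co (ap w t) i.

HB.lock Definition field_along (M : real_model) (r : real M) (F w : M) (t : real M) (i : M) :
  real M := co (ap F (opair t (seg r w t))) i.

Section Coordinates.
Variable M : real_model.
Local Notation R := (real M).

Lemma fcoE (w i : M) (t : R) : fco w t i = co (ap w t) i.
Proof. by rewrite fco.unlock. Qed.

Lemma field_alongE (r t : R) (F w i : M) :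
  field_along r F w t i = co (ap F (opair t (seg r w t))) i.
Proof. by rewrite field_along.unlock. Qed.

Lemma definable_term_co b k (v i : @ctx M k -> M) :
  definable_term b v -> definable_term b i -> definable_term b (fun c => real_val (co (v c) (i c))).
Proof. by move=> dv di; rewrite /co; definable_tac. Qed.

Lemma definable_term_fco b k (w i : @ctx M k -> M) (t : @ctx M k -> R) :
  definable_term b w -> definable_term b (fun c => real_val (t c)) -> definable_term b i ->
  definable_term b (fun c => real_val (fco (w c) (t c) (i c))).
Proof.
rewrite fco.unlock => dw dt di; apply: definable_term_co => //.
exact: (definable_term_ap dw dt).
Qed.

Lemma definable_term_field_along b k (r t : @ctx M k -> R) (F w i : @ctx M k -> M) :
  definable_term b (fun c => real_val (r c)) -> definable_term b F -> definable_term b w ->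
  definable_term b (fun c => real_val (t c)) -> definable_term b i ->
  definable_term b (fun c => real_val (field_along (r c) (F c) (w c) (t c) (i c))).
Proof.
rewrite field_along.unlock => dr dF dw dt di; apply: definable_term_co => //.
exact: (definable_term_ap dF (definable_term_opair dt (definable_term_seg dr dw dt))).
Qed.
End Coordinates.

Ltac definable_coordinate_rule := match goal with
  | H : @definable_term _ ?b 1 (fun c => real_val (?g (ctop c)))
    |- definable_term ?b (fun c => real_val (?g (@?v c))) =>
      refine (definable_term_subst (h := fun u => real_val (g u)) (v := v) H _)
  | |- definable_term _ (fun c => real_val (co _ _)) => refine (definable_term_co _ _)
  | |- definable_term _ (fun c => real_val (fco _ _ _)) => refine (definable_term_fco _ _ _)
  | |- definable_term _ (fun c => real_val (field_along _ _ _ _ _)) =>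
      refine (definable_term_field_along _ _ _ _ _)
  end.
Ltac definable_rule ::=
  first [definable_analysis_rules | definable_real_rule | definable_coordinate_rule].

Section Vectors.
Variable M : real_model.
Local Notation R := (real M).
Local Notation HK := (rm_axioms M).
Variable d : M.
Hypotheses (d_nat : d ∈ omega) (d_pos : d <> empty).
Implicit Types (a b c e s t : R) (i u v w : M).

(** A coordinate is needed for the supremum in [vnorm] to be over a nonempty set, and for norms to
    be nonnegative. *)
Lemma dim_ex : exists i, i ∈ d.
Proof.
apply: contrapT => N; apply: d_pos; apply: ext_eq => i; split=> [id|].
  by case: N; exists i.
rewrite in_setof //; have [z z0] := ex_empty M; exists z => w.
by split=> // /z0.
Qed.

Lemma in_Rvec v : v ∈ Rvec d <-> is_fun v d RR. Proof. exact: in_funs. Qed.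

Lemma coE v i : v ∈ Rvec d -> i ∈ d -> ap v i = co v i.
Proof. by move=> /in_Rvec vd id; rewrite real_ofK //; have [] := fun_ap vd id. Qed.

(** The dimension is a natural number of the model, so the maximum of the coordinates is found by
    induction inside the model. *)
Lemma bounded_coordinates n : n ∈ omega ->
  forall v, exists c : R, forall i, i ∈ n -> `|co v i| <= c.
Proof.
apply: (@omega_ind M (fun n => forall v, exists c : R, forall i, i ∈ n -> `|co v i| <= c)).
- by definable_tac.
- by move=> z z0 v; exists 0 => i /z0.
- move=> k m IH mE v; have [c cP] := IH v; exists (Num.max c `|co v k|) => i /mE[ik|->].
    by rewrite le_max cP.
  by rewrite le_max lexx orbT.
Qed.

Lemma vnormP v : v ∈ Rvec d -> exists s : R, [/\ vnorm d v = s,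
  forall i, i ∈ d -> `|co v i| <= s & forall b, (forall i, i ∈ d -> `|co v i| <= b) -> s <= b].
Proof.
move=> vd; have [i0 i0d] := dim_ex.
have [|||s s1 s2] := @real_lub M (fun a => exists i, i ∈ d /\ a = `|co v i|).
- by definable_tac.
- by exists `|co v i0|, i0.
- by have [c cP] := bounded_coordinates d_nat v; exists c => a [i [id ->]]; exact: cP.
have E i : i ∈ d -> rabs (ap v i) = real_val `|co v i| by move=> id; rewrite coE // rabsE.
exists s; split=> [|i id|b bP]; last 2 first.
- by apply: s1; exists i.
- by apply: s2 => a [i [id ->]]; exact: bP.
apply: rsupE => [a [i [id]]|b bP|u [i [id ->]]].
- by rewrite E // => /real_inj->; apply: s1; exists i.
- by apply: s2 => a [i [id ->]]; apply: bP; exists i; rewrite E.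
- by rewrite E //; exact: real_valP.
Qed.

Lemma vsub_co u v : u ∈ Rvec d -> v ∈ Rvec d ->
  vsub d u v ∈ Rvec d /\ forall i, i ∈ d -> co (vsub d u v) i = co u i - co v i.
Proof.
move=> ud vd; have D : definable_term false (fun c : ctx 1 => rsub (ap u (ctop c)) (ap v (ctop c))).
  by definable_tac.
have E i : i ∈ d -> rsub (ap u i) (ap v i) = real_val (co u i - co v i).
  by move=> id; rewrite !coE.
split=> [|i id]; last by rewrite {1}/co ap_lam // E // real_valK.
by apply/in_Rvec/is_fun_lam => // i id; rewrite E //; exact: real_valP.
Qed.

Lemma vdiv_co u c : u ∈ Rvec d -> c != 0 ->
  vdiv d u c ∈ Rvec d /\ forall i, i ∈ d -> co (vdiv d u c) i = co u i / c.
Proof.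
move=> ud c0; have D : definable_term false (fun k : ctx 1 => rdiv (ap u (ctop k)) c).
  by definable_tac.
have E i : i ∈ d -> rdiv (ap u i) c = real_val (co u i / c).
  by move=> id; rewrite !coE // rdivE.
split=> [|i id]; last by rewrite {1}/co ap_lam // E // real_valK.
by apply/in_Rvec/is_fun_lam => // i id; rewrite E //; exact: real_valP.
Qed.

Lemma vdist_lt u v e : u ∈ Rvec d -> v ∈ Rvec d -> rlt (vnorm d (vsub d u v)) e ->
  forall i, i ∈ d -> `|co u i - co v i| < e.
Proof.
move=> ud vd; have [sd sE] := vsub_co ud vd; have [s [-> s1 _]] := vnormP sd.
move=> /rltE se i id; rewrite -sE //; exact: le_lt_trans (s1 _ id) se.
Qed.

(** Bounds on the coordinates reach their supremum only as weak inequalities, hence the margin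
    between [a] and [e]; callers holding strict bounds take [a] to be [e / 2]. *)
Lemma lt_vdist u v a e : u ∈ Rvec d -> v ∈ Rvec d -> a < e ->
  (forall i, i ∈ d -> `|co u i - co v i| <= a) -> rlt (vnorm d (vsub d u v)) e.
Proof.
move=> ud vd ae; have [sd sE] := vsub_co ud vd; have [s [-> _ s2]] := vnormP sd.
by move=> H; apply/rltE; apply: le_lt_trans ae; apply: s2 => i id; rewrite sE // H.
Qed.

(** Nothing is lost in passing to coordinates: a standard [e / 2] bounds all of them at once, hence
    also their supremum. *)
Lemma vnearE u v : u ∈ Rvec d -> v ∈ Rvec d ->
  vnear d u v <-> forall i, i ∈ d -> near (co u i) (co v i).
Proof.
move=> ud vd; have [sd sE] := vsub_co ud vd; have [s [vs s1 s2]] := vnormP sd.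
rewrite /vnear vs infinitesimalE; split=> [H i id|H e se e0].
  rewrite nearB => e se e0.
  rewrite -sE //; apply: le_lt_trans (s1 _ id) (le_lt_trans (ler_norm _) _); exact: H.
have [i0 i0d] := dim_ex; have s0 : 0 <= s := le_trans (normr_ge0 _) (s1 _ i0d).
rewrite ger0_norm //; have : s <= e / 2; last by lra.
apply: s2 => i id; rewrite sE //; apply: ltW; apply: near_lt (H i id) _ _; first by std_tac.
by lra.
Qed.

Lemma vlimited_co v (k : R) : v ∈ Rvec d -> standard (k : M) ->
  (forall i, i ∈ d -> `|co v i| <= k) -> vlimited d v.
Proof.
move=> vd sk H; have [s [vs s1 s2]] := vnormP vd; rewrite /vlimited vs limitedE.
have [i0 i0d] := dim_ex; have s0 : 0 <= s := le_trans (normr_ge0 _) (s1 _ i0d).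
exists (k + 1); first by std_tac.
rewrite ger0_norm //; have := s2 _ H; split; lra.
Qed.

Lemma rabsBE a b : rabs (rsub a b) = real_val `|a - b|. Proof. exact: (rabsE (a - b)). Qed.

Definition vector_on (A w : M) : Prop := forall t : R, (t : M) ∈ A -> ap w t ∈ Rvec d.

Lemma continuous_onE A w : subset A RR -> vector_on A w ->
  continuous_on d A w <-> forall t, (t : M) ∈ A -> forall e, 0 < e ->
    exists2 h : R, 0 < h & forall s, (s : M) ∈ A -> `|s - t| < h ->
      forall i, i ∈ d -> `|fco w s i - fco w t i| < e.
Proof.
move=> AR wA; split=> H.
  move=> t tA e e0; have [|h [/real_ex[{}h ->] [/rlt0E h0 hP]]] := H t tA e (real_valP e).
    exact/rlt0E.
  exists h => // s sA sh i id; rewrite !fcoE; apply: vdist_lt => //; [exact: wA|exact: wA|].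
  by apply: hP => //; rewrite rabsBE; apply/rltE.
move=> u uA; have [t tE] := real_ex (AR _ uA); subst u => v vR.
have [e eE] := real_ex vR; subst v => /rlt0E e0; have [|h h0 hP] := H t uA (e / 2); first by lra.
exists h; split; first exact: real_valP.
split=> [|w' wA']; first exact/rlt0E.
have [s sE] := real_ex (AR _ wA'); subst w'; rewrite rabsBE => /rltE sh.
apply: (@lt_vdist _ _ (e / 2)); [exact: wA|exact: wA|by lra|].
by move=> i id; rewrite -!fcoE; apply: ltW; exact: hP.
Qed.

(** At the supremum of the times up to which [w] is bounded, continuity with tolerance 1 extends the
    bound further. The bound may be unlimited; it only ensures that sup norms exist. *)
Lemma bounded_continuous A w (a b : R) : subset A RR -> vector_on A w ->
  continuous_on d A w -> a <= b -> (forall t, a <= t <= b -> (t : M) ∈ A) ->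
  exists c : R, forall t i, a <= t <= b -> i ∈ d -> `|fco w t i| <= c.
Proof.
move=> AR wA /(continuous_onE AR wA) wc ab abA.
pose P t := a <= t <= b /\
  exists c : R, forall s, a <= s -> s <= t -> forall i, i ∈ d -> `|fco w s i| <= c.
have bounded_at t : (t : M) ∈ A -> exists c, forall i, i ∈ d -> `|fco w t i| <= c.
  move=> tA; have [c cP] := bounded_coordinates d_nat (ap w t).
  by exists c => i id; rewrite fcoE; exact: cP.
have Pa : P a.
  split; first by rewrite lexx.
  have [c cP] := bounded_at a (abA a (introT andP (conj (lexx a) ab))).
  by exists c => s as1 as2; have -> : s = a by apply/eqP; rewrite eq_le as1 as2.
have [|||s s1 s2] := @real_lub M P; first by rewrite /P; definable_tac.
- by exists a.
- by exists b => t [/andP[]].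
have as_ : a <= s by exact: s1.
have sb : s <= b by apply: s2 => t [/andP[]].
have sA : (s : M) ∈ A by apply: abA; rewrite as_ sb.
have [h h0 hP] := wc s sA 1 ltr01.
have [t [/andP[at_ tb] [c cP]] tsh] : exists2 t, P t & s - h < t by apply: lub_lt s2 _; lra.
have [c' c'P] := bounded_at s sA.
have Pnew t' : a <= t' <= b -> t' < s + h -> P t'.
  move=> t'ab t'h; split=> //; exists (Num.max c (c' + 1)) => q aq qt' i id.
  have [qt|tq] := leP q t; rewrite le_max; first by rewrite cP.
  apply/orP; right; have qA : (q : M) ∈ A by apply: abA; case/andP: t'ab; lra.
  have := hP q qA _ i id; have := c'P i id; have := norm_le_dist (fco w q i) (fco w s i).
  rewrite ltr_norml => H1 H2 H3; have : `|fco w q i - fco w s i| < 1; last by lra.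
  by apply: H3; lra.
have [bh|hb] := ltP b (s + h).
  have [|_ [c0 c0P]] := Pnew b _ bh; first by rewrite ab lexx.
  by exists c0 => q i /andP[aq qb] id; exact: c0P.
have : s + h / 2 <= s; last by lra.
by apply: s1; apply: Pnew; lra.
Qed.

End Vectors.

(** * Standard parts *)

Section Shadow.
Variable M : real_model.
Local Notation R := (real M).
Implicit Types (a b c e s t : R) (i u v w : M).

(** Standardizing the subgraph [c <= g u] gives a standard set [Q] whose section at a standard [u]
    is a lower cut, with supremum near [g u]. The suprema depend on [Q] alone, so they form a
    standard function although [g] need not be standard. *)
Lemma shadow_fun (E : M) (g : M -> R) : standard E ->
  definable_term false (fun c : ctx 1 => real_val (g (ctop c))) ->
  (forall u, standard u -> u ∈ E -> lim (g u)) ->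
  exists Z, [/\ standard Z, is_fun Z E RR &
    forall u, standard u -> u ∈ E -> near (co Z u) (g u)].
Proof.
move=> sE dg lg.
have [||Q [sQ QP]] := @standardization M
  (fun p => exists u, exists c : R, p = opair u c /\ c <= g u) (prod E RR).
- by definable_tac.
- by std_tac.
have QE u (c : R) : standard u -> standard (c : M) -> u ∈ E -> opair u c ∈ Q <-> c <= g u.
  move=> su sc uE; rewrite QP; last by std_tac.
  split=> [[_ [u' [c' [/opair_inj[-> /real_inj->]]]]]//|H].
  by split; [apply/in_prod; split=> //; exact: real_valP|exists u, c].
pose (sup := fun u : M => rsup (fun v : M => v ∈ RR /\ opair u v ∈ Q)).
have dsup (b : bool) : (b -> standard Q) -> definable_term b (fun c : ctx 1 => sup (ctop c)).
  by case: b => sQ'; rewrite /sup; definable_tac.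
have supP u : standard u -> u ∈ E -> exists s : R, sup u = s /\ near s (g u).
  move=> su uE; have [k sk gk] := lg u su uE.
  (* [Q] is described at standard points only; as [Q], [u] and [b] are standard, transfer extends an
     upper bound [b] to all members of the section. *)
  have trans (b : R) : standard (b : M) ->
      (forall c : R, standard (c : M) -> c <= g u -> c <= b) ->
      forall c : R, opair u c ∈ Q -> c <= b.
    move=> sb H; apply: real_transfer => [|c sc]; first by definable_tac.
    by rewrite QE //; exact: H.
  have ubk (c : R) : opair u c ∈ Q -> c <= k.
    by apply: trans => // c' _; move: gk; rewrite ler_norml; lra.
  have [|||s s1 s2] := @real_lub M (fun c : R => opair u c ∈ Q); first by definable_tac.
  - exists (- k); rewrite QE //; last by std_tac.
    by move: gk; rewrite ler_norml; lra.
  - by exists k.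
  have ss : sup u = s.
    apply: rsupE => [a []|b bP|v []]//; first by move=> _; exact: s1.
    by apply: s2 => a aQ; apply: bP; split=> //; exact: real_valP.
  have sts : standard (s : M) by rewrite -ss /sup; std_tac.
  exists s; split=> //; rewrite nearB => e se e0; rewrite ltr_norml; apply/andP; split.
    rewrite ltNge; apply/negP => H; have : s + e <= s; last by lra.
    by apply: s1; rewrite QE //; [lra|std_tac].
  rewrite ltNge; apply/negP => H; have : s <= s - e; last by lra.
  by apply: s2; apply: trans => [|c _ cg]; [std_tac|lra].
(* [supP] covers standard [u]; transfer makes the supremum a real at the remaining points of [E]. *)
have supR : forall u, u ∈ E -> sup u ∈ RR.
  apply: transfer => [|u su uE]; first by have dt := dsup true (fun=> sQ); definable_tac.
  by have [s [-> _]] := supP u su uE; exact: real_valP.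
have df := dsup false (fun f => match notF f with end).
exists (lam E sup); split.
- by have dt := dsup true (fun=> sQ); std_tac.
- exact: is_fun_lam.
- move=> u su uE; rewrite /co ap_lam //; have [s [-> ns]] := supP u su uE.
  by rewrite real_valK.
Qed.

(** The standard function attached to a constant function, read off at 0. *)
Lemma shadow a : lim a -> exists2 b : R, standard (b : M) & near b a.
Proof.
move=> la; have [|||Z [sZ ZR Zn]] := @shadow_fun RR (fun=> a).
- exact: std_RR.
- by definable_tac.
- by [].
exists (co Z (0 : R)); first by std_tac.
apply: Zn; [exact: std_zero|exact: (real_valP (0 : R))].
Qed.

Lemma shadow_in a b s : standard (a : M) -> standard (b : M) -> a <= s <= b ->
  exists t : R, [/\ standard (t : M), near t s & a <= t <= b].
Proof.
move=> sa sb /andP[as_ sb_]; have [|t st ts] := @shadow s.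
  exists (`|a| + `|b|); first by std_tac.
  have := ler_norm b; have := ler_norm (- a); rewrite normrN ler_norml.
  have := normr_ge0 a; have := normr_ge0 b; lra.
exists t; split=> //; apply/andP; split.
  exact: near_le (near_refl a) (near_sym ts) as_ sa st.
exact: near_le (near_sym ts) (near_refl b) sb_ st sb.
Qed.

End Shadow.

(** * Segments and functionals *)

Section FunctionSpaces.
Variable M : real_model.
Local Notation R := (real M).
Variables (d : M) (r : R).
Hypotheses (d_nat : d ∈ omega) (d_pos : d <> empty) (r_ge0 : 0 <= r).
Implicit Types (a b c e s t th : R) (i u v w p q : M).

Local Notation hist := (Icc (ropp (real_val r)) rzero).

Lemma in_histE th : (th : M) ∈ hist <-> - r <= th <= 0.
Proof. exact: (in_IccE (- r) 0 th). Qed.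

Lemma hist_real : subset hist RR.
Proof. by move=> u /in_Icc[]. Qed.

Lemma in_Cspace p :
  p ∈ Cspace d r <-> is_fun p hist (Rvec d) /\ continuous_on d hist p.
Proof.
apply: (@in_setof_sub M (fun p => is_fun p hist (Rvec d) /\ continuous_on d hist p)
  (funs hist (Rvec d))); first by definable_tac.
by move=> q [qf _]; apply/in_funs.
Qed.

Lemma is_fun_vector_on A w : is_fun w A (Rvec d) -> vector_on d A w.
Proof. by move=> wf t tA; have [] := fun_ap wf tA. Qed.

Lemma Cspace_vector_on p : p ∈ Cspace d r -> vector_on d hist p.
Proof. by move/in_Cspace => [/is_fun_vector_on]. Qed.

(** Without a bound the supremum in [Cnorm] might not exist, and [Cnorm] would be the default value
    of [the]. *)
Lemma CdistP p q : vector_on d hist p -> vector_on d hist q ->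
  (exists c, forall th i, - r <= th <= 0 -> i ∈ d -> `|fco p th i - fco q th i| <= c) ->
  exists s : R, [/\ Cnorm d r (Csub d r p q) = s,
    forall th i, - r <= th <= 0 -> i ∈ d -> `|fco p th i - fco q th i| <= s &
    forall b, (forall th i, - r <= th <= 0 -> i ∈ d -> `|fco p th i - fco q th i| <= b) -> s <= b].
Proof.
move=> pv qv [k kP]; have [i0 i0d] := dim_ex d_pos.
have h0 : - r <= (0 : R) <= 0 by move: r_ge0; lra.
have [|||s s1 s2] := @real_lub M (fun a => exists th : R, exists i,
    (- r <= th <= 0) /\ (i ∈ d /\ a = `|fco p th i - fco q th i|)).
- by definable_tac.
- by exists `|fco p 0 i0 - fco q 0 i0|, 0, i0.
- by exists k => a [th [i [thr [id ->]]]]; exact: kP.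
exists s; split=> [|th i thr id|b bP]; last 2 first.
- by apply: s1; exists th, i.
- by apply: s2 => a [th [i [thr [id ->]]]]; exact: bP.
have D : definable_term false (fun c : ctx 1 => vsub d (ap p (ctop c)) (ap q (ctop c))).
  by definable_tac.
have N th : - r <= th <= 0 -> exists t : R, [/\ vnorm d (ap (Csub d r p q) th) = t,
    forall i, i ∈ d -> `|fco p th i - fco q th i| <= t &
    forall b, (forall i, i ∈ d -> `|fco p th i - fco q th i| <= b) -> t <= b].
  move=> /in_histE thr; rewrite /Csub ap_lam //.
  have [vd vE] := vsub_co (pv _ thr) (qv _ thr).
  have [t [-> t1 t2]] := vnormP d_nat d_pos vd; exists t; split=> // [i id|b bP].
    by rewrite !fcoE -vE //; exact: t1.
  by apply: t2 => i id; rewrite vE // -!fcoE; exact: bP.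
apply: rsupE => [a [u [uh]]|b bP|u [w [wh ->]]].
- have [th E] := real_ex (hist_real uh); subst u; move/in_histE: uh => thr.
  have [t [-> _ t2]] := N th thr; move/real_inj => ->.
  by apply: t2 => i id; apply: s1; exists th, i.
- apply: s2 => a [th [i [thr [id ->]]]]; have [t [tE t1 _]] := N th thr.
  by apply: le_trans (t1 i id) _; apply: bP; exists th; split=> //; apply/in_histE.
- have [th E] := real_ex (hist_real wh); subst w; move/in_histE: wh => thr.
  by have [t [-> _ _]] := N th thr; exact: real_valP.
Qed.

Lemma lt_Cdist p q a e : vector_on d hist p -> vector_on d hist q -> a < e ->
  (forall th i, - r <= th <= 0 -> i ∈ d -> `|fco p th i - fco q th i| <= a) ->
  rlt (Cnorm d r (Csub d r p q)) e.
Proof.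
move=> pv qv ae H; have [|s [-> _ s2]] := CdistP pv qv; first by exists a.
by apply/rltE; apply: le_lt_trans ae; exact: s2.
Qed.

Lemma Cnear_co p q : p ∈ Cspace d r -> q ∈ Cspace d r -> Cnear d r p q ->
  forall th i, - r <= th <= 0 -> i ∈ d -> near (fco p th i) (fco q th i).
Proof.
move=> pC qC; have pv := Cspace_vector_on pC; have qv := Cspace_vector_on qC.
have r0 : - r <= 0 by move: r_ge0; lra.
have bd w : w ∈ Cspace d r ->
    exists c : R, forall th i, - r <= th <= 0 -> i ∈ d -> `|fco w th i| <= c.
  move=> wC; have /in_Cspace[_ wc] := wC.
  apply: (bounded_continuous d_nat d_pos hist_real (Cspace_vector_on wC) wc r0).
  by move=> t /in_histE.
have [c1 c1P] := bd p pC; have [c2 c2P] := bd q qC.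
have [|s [sE s1 _]] := CdistP pv qv.
  exists (c1 + c2) => th i thr id; have := c1P th i thr id; have := c2P th i thr id.
  by have := ler_normB (fco p th i) (fco q th i); lra.
rewrite /Cnear sE infinitesimalE => ss th i thr id; rewrite nearB => e se e0.
by apply: le_lt_trans (s1 _ _ thr id) (le_lt_trans (ler_norm _) _); exact: ss.
Qed.

Lemma fco_seg w t th i : - r <= th <= 0 -> fco (seg r w t) th i = fco w (t + th) i.
Proof.
move=> /in_histE thr.
have D : definable_term false (fun c : ctx 1 => ap w (radd t (ctop c))) by definable_tac.
by rewrite !fcoE /seg ap_lam.
Qed.

(* The plain [rewrite] avoids unifying distinct segments up to conversion. *)
Lemma near_seg w w' s t th i : - r <= th <= 0 ->
  near (fco w (s + th) i) (fco w' (t + th) i) ->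
  near (fco (seg r w s) th i) (fco (seg r w' t) th i).
Proof.
move=> thr; have E1 := fco_seg w s i thr; have E2 := fco_seg w' t i thr.
by rewrite -> E1, E2.
Qed.

Lemma seg_Cspace X w t : subset X RR -> vector_on d X w ->
  (0 < r -> continuous_on d X w) -> (forall s, t - r <= s <= t -> (s : M) ∈ X) ->
  seg r w t ∈ Cspace d r.
Proof.
move=> XR wv wc tX.
have D : definable_term false (fun c : ctx 1 => ap w (radd t (ctop c))) by definable_tac.
have shift th : - r <= th <= 0 -> ((t + th : R) : M) ∈ X.
  by move=> thr; apply: tX; move: thr; lra.
have sf : is_fun (seg r w t) hist (Rvec d).
  apply: is_fun_lam => // u uh; have [th E] := real_ex (hist_real uh); subst u.
  by move/in_histE: uh => /shift; exact: wv.
apply/in_Cspace; split=> //; have sv := is_fun_vector_on sf.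
apply/(continuous_onE d_nat d_pos hist_real sv) => th /in_histE thr e e0.
have [r0|r0] := ltP 0 r.
  have [h h0 hP] := (proj1 (continuous_onE d_nat d_pos XR wv) (wc r0)) _ (shift th thr) e e0.
  exists h => // th' /in_histE thr' th'h i id; rewrite !fco_seg //.
  apply: hP => //; first exact: shift.
  by rewrite (_ : t + th' - (t + th) = th' - th) //; lra.
(* For [r = 0] the history is the single point 0, where every function is continuous and any modulus
   works. *)
exists 1 => // th' /in_histE thr' _ i id.
have -> : th' = th by move: thr thr'; lra.
by rewrite subrr normr0.
Qed.

Hypotheses (d_std : standard d) (r_std : standard (r : M)).

Lemma standard_continuous A w t s i : subset A RR -> vector_on d A w ->
  continuous_on d A w -> standard A -> standard w -> standard (t : M) ->
  (t : M) ∈ A -> (s : M) ∈ A -> near s t -> i ∈ d -> near (fco w s i) (fco w t i).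
Proof.
move=> AR wv /(continuous_onE d_nat d_pos AR wv) wc sA sw st tA sA' nst id.
rewrite nearB => e se e0.
have [||h sh [h0 hP]] := @real_transfer_ex M (fun h : R => 0 < h /\ forall s : R, (s : M) ∈ A ->
   `|s - t| < h -> forall i, i ∈ d -> `|fco w s i - fco w t i| < e).
- by definable_tac.
- by have [h h0 hP] := wc t tA e e0; exists h.
- by apply: hP => //; exact: near_lt nst sh h0.
Qed.

(** Neither point need be standard: both are near a common standard point, which the standard bounds
    [a] and [b] keep in the domain, and continuity there applies twice. *)
Lemma standard_uniform A w a b s t i : subset A RR -> vector_on d A w ->
  continuous_on d A w -> standard A -> standard w -> standard (a : M) -> standard (b : M) ->
  (forall q : R, a <= q <= b -> (q : M) ∈ A) -> a <= s <= b -> a <= t <= b -> near s t ->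
  i ∈ d -> near (fco w s i) (fco w t i).
Proof.
move=> AR wv wc sA sw sa sb abA sab tab nst id.
have [q [sq qs qab]] := shadow_in sa sb sab.
have H c : a <= c <= b -> near c q -> near (fco w c i) (fco w q i).
  by move=> cab cq; apply: (standard_continuous AR wv wc sA sw sq (abA _ qab) (abA _ cab) cq).
apply: near_trans (H s sab (near_sym qs)) (near_sym (H t tab _)).
exact: near_trans (near_sym nst) (near_sym qs).
Qed.

Lemma standard_bound v : v ∈ Rvec d -> standard v ->
  exists2 k : R, standard (k : M) & forall i, i ∈ d -> `|co v i| <= k.
Proof.
move=> vd sv; apply: real_transfer_ex; first by definable_tac.
exact: bounded_coordinates.
Qed.

Lemma has_derivativeI A w t v : subset A RR -> vector_on d A w -> (t : M) ∈ A -> v ∈ Rvec d ->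
  (forall e, 0 < e -> exists2 h : R, 0 < h & forall s, (s : M) ∈ A -> s != t -> `|s - t| < h ->
     forall i, i ∈ d -> `|fco w s i - fco w t i - (s - t) * co v i| <= e * `|s - t|) ->
  has_derivative d A w t v.
Proof.
move=> AR wv tA vd H u uR; have [e E] := real_ex uR; subst u => /rlt0E e0.
have [|h h0 hP] := H (e / 2); first by lra.
exists h; split; first exact: real_valP.
split=> [|q qA]; first exact/rlt0E.
have [s E] := real_ex (AR _ qA); subst q => st; rewrite rabsBE => /rltE sh.
have st' : s != t by apply/eqP => E; apply: st; rewrite E.
have st0 : s - t != 0 by rewrite subr_eq0.
have [sd sE] := vsub_co (wv s qA) (wv t tA); have [dd dE] := vdiv_co sd st0.
apply: (@lt_vdist _ _ d_nat d_pos _ _ (e / 2)) => // [|i id]; first by lra.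
by rewrite dE // sE // -!fcoE slope_le //; exact: hP.
Qed.

Variable F : M.
Hypotheses (F_cont : continuous_functional d r F)
  (F_fun : is_fun F (prod (Ici (rzero : M)) (Cspace d r)) (Rvec d)) (F_std : standard F).

Lemma F_vector t p : 0 <= t -> p ∈ Cspace d r -> ap F (opair t p) ∈ Rvec d.
Proof.
move=> t0 pC; apply: (proj1 (fun_ap F_fun _)).
by apply/in_prod; split=> //; apply/(in_IciE 0 t).
Qed.

(** As [t] and [p] are standard, so is, by transfer, a modulus of continuity of [F] at that point;
    [s] and [q] may be nonstandard. *)
Lemma F_near t s p q : 0 <= t -> 0 <= s -> p ∈ Cspace d r -> q ∈ Cspace d r ->
  standard (t : M) -> standard p -> near s t ->
  (forall th i, - r <= th <= 0 -> i ∈ d -> near (fco q th i) (fco p th i)) ->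
  forall i, i ∈ d -> near (co (ap F (opair s q)) i) (co (ap F (opair t p)) i).
Proof.
move=> t0 s0 pC qC st sp nst npq i id; rewrite nearB => e se e0.
have [||h sh [h0 hP]] := @real_transfer_ex M (fun h : R => 0 < h /\ forall u q,
   u ∈ Ici (rzero : M) -> q ∈ Cspace d r -> rlt (rabs (rsub u t)) h ->
   rlt (Cnorm d r (Csub d r q p)) h ->
   rlt (vnorm d (vsub d (ap F (opair u q)) (ap F (opair t p)))) e).
- by definable_tac.
- have [||||h [/real_ex[{}h ->] [/rlt0E h0 hP]]] := @F_cont t p _ _ e; try done.
  + exact/(in_IciE 0 t).
  + exact: real_valP.
  + exact/rlt0E.
  by exists h.
apply: (vdist_lt d_nat d_pos) id; [exact: F_vector|exact: F_vector|apply: hP => //].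
- exact/(in_IciE 0 s).
- by rewrite rabsBE; apply/rltE; exact: near_lt nst sh h0.
- apply: (@lt_Cdist _ _ (h / 2)); [exact: Cspace_vector_on|exact: Cspace_vector_on|by lra|].
  by move=> th j thr jd; apply: ltW; apply: near_lt (npq th j thr jd) _ _; [std_tac|lra].
Qed.

Lemma field_near w w' t s i : 0 <= t -> 0 <= s ->
  seg r w t ∈ Cspace d r -> seg r w' s ∈ Cspace d r ->
  standard (t : M) -> standard w -> near s t ->
  (forall th j, - r <= th <= 0 -> j ∈ d -> near (fco w' (s + th) j) (fco w (t + th) j)) ->
  i ∈ d -> near (field_along r F w' s i) (field_along r F w t i).
Proof.
move=> t0 s0 wC w'C st sw nst H id.
have sseg : standard (seg (real_val r) w t) by std_tac.
have E1 := field_alongE r s F w' i; have E2 := field_alongE r t F w i; rewrite -> E1, E2.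
apply: (F_near t0 s0 wC w'C st sseg nst) => // th j thr jd.
by apply: near_seg => //; exact: H.
Qed.

(** A vector function on [D] is one real function on pairs [(t, i)], so a single use of [shadow_fun]
    on [prod D d] covers all coordinates. [coord] decodes the pair. *)
Lemma shadow_vfun (D x : M) : standard D -> subset D RR ->
  (forall t i, standard (t : M) -> (t : M) ∈ D -> i ∈ d -> lim (fco x t i)) ->
  exists z, [/\ standard z, is_fun z D (Rvec d) &
    forall t i, standard (t : M) -> (t : M) ∈ D -> i ∈ d -> near (fco z t i) (fco x t i)].
Proof.
move=> sD DR xlim.
pose (coord := fun u : M => the (fun v : M => exists t i, u = opair t i /\ v = ap (ap x t) i)).
have coordE t i : coord (opair t i) = ap (ap x t) i.
  apply: the_eq; first by exists t, i.
  by move=> v [t' [i' [/opair_inj[-> ->] ->]]].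
have Dc : definable_term false (fun c : ctx 1 => real_val (real_of (coord (ctop c)))).
  by rewrite /coord; definable_tac.
have [||Z [sZ Zf Zn]] := shadow_fun (E := prod D d) (g := fun u => real_of (coord u)) _ Dc.
- by std_tac.
- move=> u su /mem_prod[t [i [tD [id E]]]]; have [t' tE] := real_ex (DR _ tD); subst t u.
  rewrite coordE -/(co (ap x t') i) -fcoE; apply: xlim => //.
  (* The time is standard because, by transfer, a standard pair has a standard first component. *)
  have [||v [sv [j /opair_inj[-> _]]]//] := @transfer_ex M
    (fun v => exists j, opair t' i = opair v j).
    by definable_tac.
  by exists (real_val t'), i.
have Di (t : M) : definable_term false (fun c : ctx 1 => ap Z (opair t (ctop c))) by definable_tac.
have Dt : definable_term false (fun c : ctx 1 => lam d (fun i => ap Z (opair (ctop c) i))).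
  by definable_tac.
have zt (t : M) : t ∈ D -> lam d (fun i => ap Z (opair t i)) ∈ Rvec d.
  move=> tD; apply/in_Rvec; apply: is_fun_lam => // i id.
  by apply: (proj1 (fun_ap Zf _)); apply/in_prod.
exists (lam D (fun t : M => lam d (fun i => ap Z (opair t i)))); split.
- by std_tac.
- exact: is_fun_lam.
move=> t i st tD id; have si := standard_in_omega d_nat d_std id.
have ti : standard (opair (real_val t) i) by std_tac.
have tiD : opair (real_val t) i ∈ prod D d by apply/in_prod.
by have := Zn _ ti tiD; rewrite coordE !fcoE ap_lam // {2}/co ap_lam.
Qed.
End FunctionSpaces.

(** * The stroboscopic argument *)

Section Stroboscopy.
Variable M : real_model.
Local Notation R := (real M).
Variables (d : M) (r : R).
Hypotheses (d_nat : d ∈ omega) (d_pos : d <> empty) (d_std : standard d).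
Hypotheses (r_ge0 : 0 <= r) (r_std : standard (r : M)).
Local Notation hist := (Icc (ropp (real_val r)) rzero).
Variables phi F : M.
Hypotheses (phi_C : phi ∈ Cspace d r) (phi_std : standard phi)
  (F_fun : is_fun F (prod (Ici (rzero : M)) (Cspace d r)) (Rvec d))
  (F_cont : continuous_functional d r F) (F_std : standard F).
Variables I x : M.
Hypotheses (I_sub : subset I RR) (I_init : subset hist I) (x_fun : is_fun x I (Rvec d))
  (x_cont : 0 < r -> continuous_on d I x) (x_init : Cnear d r (seg r x (rzero : M)) phi)
  (x_strob : stroboscopic d r F I x).
Variables y J : M.
Hypotheses (y_std : standard y) (J_std : standard J) (y_sol : solution d r F phi y J)
  (y_unique : forall z E, solution d r F phi z E -> subset z y).
Variable L : R.
Hypotheses (L_std : standard (L : M)) (L_in : (L : M) ∈ J) (L_gt0 : 0 < L).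
Implicit Types (a b e s t th k : R) (i : M).

Local Notation X := (fco x).
Local Notation Y := (fco y).
Local Notation FX := (field_along r F x).
Local Notation FY := (field_along r F y).

Let JR : subset J RR. Proof. by case: y_sol => -[]. Qed.
Let y_fun : is_fun y J (Rvec d). Proof. by case: y_sol => _ [_ []]. Qed.
Let y_cont : continuous_on d J y. Proof. by case: y_sol => _ [_ [_ []]]. Qed.
Let yv : vector_on d J y. Proof. exact: is_fun_vector_on. Qed.
Let xv : vector_on d I x. Proof. exact: is_fun_vector_on. Qed.

Let y_hist t i : - r <= t <= 0 -> Y t i = fco phi t i.
Proof. by case: y_sol => _ [_ [_ [_ [H _]]]] /in_histE/H; rewrite !fcoE => ->. Qed.

(** * Closeness of [x] to [y] and its effect on the field *)

Lemma in_J t : - r <= t <= L -> (t : M) ∈ J.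
Proof.
case: y_sol => -[_ [rJ [_ conv]]] _ /andP[rt tL].
by apply: (conv _ _ _ rJ L_in); [exact/(rleE (- r) t)|exact/rleE].
Qed.

Lemma y_near s t i : - r <= s <= L -> - r <= t <= L -> near s t -> i ∈ d -> near (Y s i) (Y t i).
Proof.
apply: (standard_uniform d_nat d_pos d_std JR yv y_cont J_std y_std _ L_std in_J).
by std_tac.
Qed.

Lemma segy_Cspace t : 0 <= t <= L -> seg r y t ∈ Cspace d r.
Proof.
move=> t0L; apply: (seg_Cspace d_nat d_pos JR yv) => // s sr.
by apply: in_J; move: r_ge0 t0L sr; lra.
Qed.

Lemma segx_Cspace t : (forall s, 0 <= s <= t -> (s : M) ∈ I) -> 0 <= t -> seg r x t ∈ Cspace d r.
Proof.
move=> tI t0; apply: (seg_Cspace d_nat d_pos I_sub xv) => // s sr.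
have [s0|s0] := leP 0 s; first by apply: tI; move: sr; lra.
by apply/I_init/in_histE; move: t0 sr; lra.
Qed.

Lemma hist_near t i : - r <= t <= 0 -> i ∈ d -> near (X t i) (Y t i).
Proof.
move=> tr id; rewrite y_hist //; have -> : X t i = fco (seg r x (0 : R)) t i.
  by rewrite fco_seg // add0r.
apply: (Cnear_co d_nat d_pos r_ge0) => //; apply: segx_Cspace => // s s0.
by apply/I_init/in_histE; move: r_ge0 s0; lra.
Qed.

(** Membership in [I] is included because the domain of [x] is not known in advance to contain
    [[0, L]]. The bound [e] instead of [near] keeps the predicate internal. *)
Definition good e t := (0 <= t <= L) /\
  forall s, 0 <= s <= t -> (s : M) ∈ I /\ forall i, i ∈ d -> `|X s i - Y s i| <= e.

Lemma good_le e s t : 0 <= s -> s <= t -> good e t -> good e s.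
Proof.
move=> s0 st [tL H]; split=> [|q qs]; first by move: s0 st tL; lra.
by apply: H; move: st qs; lra.
Qed.

Lemma good_weaken e k t : e <= k -> good e t -> good k t.
Proof.
move=> ek [tL H]; split=> // s st; have [sI sP] := H s st; split=> // i id.
by apply: le_trans ek; exact: sP.
Qed.

Lemma good_Cspace e t : good e t -> seg r x t ∈ Cspace d r.
Proof. by move=> [/andP[t0 _] H]; apply: segx_Cspace => // s /H[]. Qed.

Lemma good_in e t s : good e t -> - r <= s <= t -> (s : M) ∈ I.
Proof.
move=> [tL H] st; have [s0|s0] := leP 0 s; first by have [] := H s; [move: st; lra|].
by apply/I_init/in_histE; move: st s0; lra.
Qed.

(** Continuity of [F] is exploited at standard points, so both fields at [t] are compared with the
    field of [y] at the standard part [u] of [t]. *)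
Lemma F_near_along t i : 0 <= t <= L ->
  (forall s, 0 <= s <= t -> (s : M) ∈ I /\ forall j, j ∈ d -> near (X s j) (Y s j)) ->
  i ∈ d -> near (FX t i) (FY t i).
Proof.
move=> tL H id.
have [u [su ut u0L]] := shadow_in (std_natr M 0) L_std tL.
have [t0 u0] : 0 <= t /\ 0 <= u by move: tL u0L; lra.
have FN w : seg r w t ∈ Cspace d r ->
    (forall th j, - r <= th <= 0 -> j ∈ d -> near (fco w (t + th) j) (Y (u + th) j)) ->
    near (field_along r F w t i) (FY u i).
  move=> wC wn.
  exact: (field_near d_nat d_pos r_ge0 d_std r_std F_cont F_fun F_std u0 t0
    (segy_Cspace u0L) wC su y_std (near_sym ut) wn id).
have yn th j : - r <= th <= 0 -> j ∈ d -> near (Y (t + th) j) (Y (u + th) j).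
  move=> thr jd; apply: y_near => //; first by move: thr tL; lra.
    by move: thr u0L; lra.
  by apply/nearB; rewrite (_ : t + th - (u + th) = t - u); [exact/nearB/near_sym|lra].
have xC : seg r x t ∈ Cspace d r by apply: segx_Cspace => // s /H[].
have xu := FN _ xC; have yu' := FN _ (segy_Cspace tL).
apply: (near_trans (b := FY u i)); [apply: xu|apply: near_sym; apply: yu'] => th j thr jd.
  apply: near_trans (yn th j thr jd).
  have [h|h] := leP 0 (t + th); last by apply: hist_near => //; move: tL thr h; lra.
  by have [|_ /(_ j jd)] := H (t + th); first by move: thr h; lra.
exact: yn.
Qed.

(** One standard bound for all times up to [t] supplies the pointwise limitedness that the
    stroboscopic property asks for. *)
Definition bounded_to t := (0 <= t <= L) /\ (forall s, 0 <= s <= t -> (s : M) ∈ I) /\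
  exists2 k : R, standard (k : M) &
    forall s i, 0 <= s <= t -> i ∈ d -> `|X s i| <= k /\ `|FX s i| <= k.

Lemma strob_step : exists2 mu : R, 0 < mu & forall t, bounded_to t -> exists t' : R,
  [/\ mu < t' - t, small (t' - t),
     forall s, t <= s <= t' -> (s : M) ∈ I /\ forall i, i ∈ d -> near (X s i) (X t i) &
     forall i, i ∈ d -> near ((X t' i - X t i) / (t' - t)) (FX t i)].
Proof.
have [u [/real_ex[mu ->] [/rlt0E mu0 H]]] := x_strob; exists mu => // t [t0L [tI [k sk kP]]].
have t0 : 0 <= t by move: t0L; lra.
have FXv s : 0 <= s <= t -> ap F (opair s (seg r x s)) ∈ Rvec d.
  move=> st; apply: (F_vector F_fun); first by move: st; lra.
  by apply: segx_Cspace => [q qs|]; [apply: tI; move: st qs; lra|move: st; lra].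
have tt : 0 <= t <= t by rewrite t0 lexx.
have xt := xv (tI _ tt).
have [|||||v [vI [mut [vt [tv [xn fn]]]]]] := H t.
- exact: tI.
- exact/rle0E.
- apply/limitedE; exists (L + 1); first by std_tac.
  by rewrite ger0_norm //; move: t0L L_gt0; lra.
- move=> w /[dup] /in_Icc[/real_ex[s ->] _] /(in_IccE 0 t); exact: tI.
- move=> w /[dup] /in_Icc[/real_ex[s ->] _] /(in_IccE 0 t) st.
  split; [apply: (vlimited_co d_nat d_pos (xv (tI s st)) sk)
         |apply: (vlimited_co d_nat d_pos (FXv s st) sk)] => i id;
  by have [] := kP s i st id; rewrite fcoE field_alongE.
have [t' E] := real_ex (I_sub vI); subst v; exists t'.
have t'_t : mu < t' - t by apply/rltE.
have xt' := xv vI.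
have tne : t' - t != 0 by apply: lt0r_neq0; lra.
split=> //.
- exact/infinitesimalE.
- move=> s st; have sI : (s : M) ∈ I by apply: tv; apply/in_IccE.
  have xst : vnear d (ap x s) (ap x t) by apply: xn; exact/in_IccE.
  split=> // i id; have E1 := fcoE x i s; have E2 := fcoE x i t; rewrite -> E1, E2.
  exact: (proj1 (vnearE d_nat d_pos (xv sI) xt)).
- have [sd sE] := vsub_co xt' xt; have [dd dE] := vdiv_co sd tne.
  move=> i id; have := proj1 (vnearE d_nat d_pos dd (FXv t tt)) fn i id.
  have E1 := fcoE x i t; have E2 := fcoE x i t'; have E3 := field_alongE r t F x i.
  by rewrite dE // sE //; rewrite -> E1, E2, E3.
Qed.

(** Guarantees a first step. Its length is a positive infinitesimal, which the spilling arguments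
    below take as their starting point. *)
Lemma bounded_to0 : bounded_to 0.
Proof.
have I0 : (real_val (0 : R)) ∈ I by apply/I_init/in_histE; move: r_ge0; lra.
have J0 : (real_val (0 : R)) ∈ J by apply: in_J; move: r_ge0 L_gt0; lra.
have L0 : 0 <= (0 : R) <= L by move: L_gt0; lra.
have s0 := std_natr M 0.
have sy0 : standard (ap y (real_val (0 : R))) by std_tac.
have sF0 : standard (ap F (opair (real_val (0 : R)) (seg r y (real_val (0 : R))))) by std_tac.
have [k1 sk1 k1P] := standard_bound d_nat d_std (yv J0) sy0.
have [k2 sk2 k2P] := standard_bound d_nat d_std
  (F_vector F_fun (lexx 0) (segy_Cspace L0)) sF0.
have only0 s : 0 <= s <= 0 -> s = 0 by move=> s00; apply/eqP; rewrite eq_le andbC.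
have xy i : i ∈ d -> near (X 0 i) (Y 0 i) by apply: hist_near; move: r_ge0; lra.
have H0 s : 0 <= s <= 0 -> (s : M) ∈ I /\ forall j, j ∈ d -> near (X s j) (Y s j).
  by move=> /only0->.
have Fxy i : i ∈ d -> near (FX 0 i) (FY 0 i) by exact: (F_near_along L0 H0).
split=> //; split=> [s /only0->//|].
have k10 : 0 <= k1 by have [i id] := dim_ex d_pos; apply: le_trans (k1P i id).
have k20 : 0 <= k2 by have [i id] := dim_ex d_pos; apply: le_trans (k2P i id).
exists (k1 + k2 + 1) => [|s i /only0-> id]; first by std_tac.
have := near_lt (xy i id) (std1 M) ltr01; have := near_lt (Fxy i id) (std1 M) ltr01.
have : `|Y 0 i| <= k1 by rewrite fcoE; exact: k1P.
have : `|FY 0 i| <= k2 by rewrite field_alongE; exact: k2P.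
have := norm_le_dist (X 0 i) (Y 0 i); have := norm_le_dist (FX 0 i) (FY 0 i); lra.
Qed.

(** For an infinitesimal [e] the two products are at most 1, since the values at [s] are near
    standard values at the standard part of [s]. Underspill makes [e] standard, and [K] is its
    inverse. *)
Lemma y_bound : exists K : R, [/\ standard (K : M), 0 < K &
  forall s i, 0 <= s <= L -> i ∈ d -> `|Y s i| <= K /\ `|FY s i| <= K].
Proof.
have [mu mu0 H] := strob_step; have [t' [t'0 st' _ _]] := H 0 bounded_to0.
rewrite subr0 in t'0 st'.
have [||||e [se e0 eP]] := @underspill M (fun e => forall s i, 0 <= s <= L -> i ∈ d ->
    e * `|Y s i| <= 1 /\ e * `|FY s i| <= 1) t' _ _ st'.
- by definable_tac.
- by lra.
- move=> a b a0 ab bP s i sL id; have [] := bP s i sL id.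
  by have := normr_ge0 (Y s i); have := normr_ge0 (FY s i); nra.
- move=> e e0 se s i sL id.
  have [u [su us uL]] := shadow_in (std_natr M 0) L_std sL.
  have si := standard_in_omega d_nat d_std id.
  have ns a b : near a b -> standard (b : M) -> e * `|a| <= 1.
    move=> ab sb; have [k sk ak] := near_lim (standard_lim sb) ab.
    have sae : small (a * e) by exact: smallM ak se.
    by have := small_lt sae (std1 M) ltr01; rewrite normrM (gtr0_norm e0) mulrC => /ltW.
  split.
    apply: (ns _ (Y u i)); last by std_tac.
    apply: y_near => //; [by move: r_ge0 sL; lra|by move: r_ge0 uL; lra|exact: near_sym].
  apply: (ns _ (FY u i)); last by std_tac.
  apply: (field_near d_nat d_pos r_ge0 d_std r_std F_cont F_fun F_std) => //.
  + by move: uL; lra.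
  + by move: sL; lra.
  + exact: segy_Cspace.
  + exact: segy_Cspace.
  + exact: near_sym.
  move=> th j thr jd; apply: y_near => //.
  + by move: thr sL; lra.
  + by move: thr uL; lra.
  + by apply/nearB; rewrite (_ : s + th - (u + th) = s - u); [exact/nearB/near_sym|lra].
exists e^-1; split; [by std_tac|by rewrite invr_gt0|].
by move=> s i sL id; have := eP s i sL id; rewrite -!ler_pdivlMl // mulr1.
Qed.

(** With an infinitesimal radius, [x] is near [y] up to a good time and [F_near_along] makes the
    fields near, hence within 1. Underspill then yields a standard radius. *)
Lemma tube_ex : exists e0 : R, [/\ standard (e0 : M), 0 < e0 &
  forall t i, good e0 t -> i ∈ d -> `|FX t i - FY t i| <= 1].
Proof.
have [mu mu0 H] := strob_step; have [t' [t'0 st' _ _]] := H 0 bounded_to0.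
rewrite subr0 in t'0 st'.
have [||||e0 [se e00 eP]] := @underspill M (fun e => forall t i, good e t -> i ∈ d ->
    `|FX t i - FY t i| <= 1) t' _ _ st'.
- by rewrite /good; definable_tac.
- by lra.
- by move=> a b a0 ab bP t i gt; apply: bP; exact: good_weaken gt.
- move=> e e0 se t i [tL gt] id; apply: ltW.
  apply: near_lt (std1 M) ltr01; apply: F_near_along => // s /gt[sI sP]; split=> // j jd.
  by apply/nearB; apply: small_le se; apply: le_trans (sP j jd) (ler_norm _).
by exists e0.
Qed.

(** * Steps and S-continuity of [x] inside the tube *)

Section Tube.
Variable e0 : R.
Hypotheses (e0_std : standard (e0 : M)) (e0_gt0 : 0 < e0)
  (e0_tube : forall t i, good e0 t -> i ∈ d -> `|FX t i - FY t i| <= 1).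

Lemma good_bounded_to t : good e0 t -> bounded_to t.
Proof.
move=> gt; have [tL tP] := gt; split=> //; split=> [s /tP[]//|].
(* One constant for both bounds: in the tube [x] is at most [K + e0] and the field at most
   [K + 1]. *)
have [K [sK K0 KP]] := y_bound; exists (K + e0 + 1); first by std_tac.
move=> s i st id; have sL : 0 <= s <= L by move: st tL; lra.
have [_ /(_ i id) Xs] := tP s st; have [YK FYK] := KP s i sL id.
have gs : good e0 s by apply: good_le gt; move: st; lra.
have := e0_tube gs id; have := norm_le_dist (X s i) (Y s i).
have := norm_le_dist (FX s i) (FY s i); move: e0_gt0; lra.
Qed.

(** Every standard positive [e] can play the part of [del], by [strob_step]. Overspill needs a
    statement free of [small] and [near], hence one number bounding the length of the step, the
    oscillation along it and the error of the slope, the last one multiplied out. *)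
Lemma fine_steps : exists mu del : R, [/\ 0 < mu, small del, 0 < del &
  forall t, good e0 t -> exists t' : R, mu < t' - t /\ t' - t <= del /\
    (forall s, t <= s <= t' -> (s : M) ∈ I /\ forall i, i ∈ d -> `|X s i - X t i| <= del) /\
    forall i, i ∈ d -> `|X t' i - X t i - (t' - t) * FX t i| <= del * (t' - t)].
Proof.
have [mu mu0 H] := strob_step; have [u [u0 su _ _]] := H 0 bounded_to0.
rewrite subr0 in u0 su.
have [||||del [sd d0 dP]] := @overspill M (fun e => forall t, good e0 t -> exists t' : R,
    mu < t' - t /\ t' - t <= e /\
    (forall s, t <= s <= t' -> (s : M) ∈ I /\ forall i, i ∈ d -> `|X s i - X t i| <= e) /\
    forall i, i ∈ d -> `|X t' i - X t i - (t' - t) * FX t i| <= e * (t' - t)) u _ _ su.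
- by rewrite /good; definable_tac.
- by lra.
- move=> a b a0 ab aP t gt; have [t' [m1 [m2 [m3 m4]]]] := aP t gt; exists t'.
  split; first exact: m1.
  split; first exact: le_trans m2 ab.
  split=> [s st|i id]; last first.
    apply: le_trans (m4 i id) _; apply: ler_wpM2r ab.
    exact: le_trans (ltW mu0) (ltW m1).
  by have [sI sP] := m3 s st; split=> // i id; apply: le_trans (sP i id) ab.
- move=> e se e_gt0 t gt; have [t' [m1 m2 m3 m4]] := H t (good_bounded_to gt); exists t'.
  have p0 : 0 < t' - t by lra.
  split; first exact: m1.
  split; first by have := small_lt m2 se e_gt0; rewrite gtr0_norm // => /ltW.
  split=> [s st|i id].
    by have [sI sP] := m3 s st; split=> // i id; apply: ltW; exact: near_lt (sP i id) se e_gt0.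
  have /ltW := near_lt (m4 i id) se e_gt0.
  by rewrite (slope_le _ _ _ (lt0r_neq0 p0)) (gtr0_norm p0).
by exists mu, del.
Qed.

Section Steps.
Variables mu del : R.
Hypotheses (mu_gt0 : 0 < mu) (del_small : small del) (del_gt0 : 0 < del).
Hypothesis steps : forall t, good e0 t -> exists t' : R, mu < t' - t /\ t' - t <= del /\
    (forall s, t <= s <= t' -> (s : M) ∈ I /\ forall i, i ∈ d -> `|X s i - X t i| <= del) /\
    forall i, i ∈ d -> `|X t' i - X t i - (t' - t) * FX t i| <= del * (t' - t).

Lemma good0 : good e0 0.
Proof.
have [L0 [I0 _]] := bounded_to0; split=> // s s0; split; first exact: I0.
move=> i id; have -> : s = 0 by apply/eqP; rewrite eq_le andbC.
apply: ltW; apply: near_lt => //; apply: hist_near => //; move: r_ge0; lra.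
Qed.

(* The supremum of the [s] in [a, b] with [|X s - X a - (s - a) v| <= (s - a) (e + del)]
   is within one step of [b], because steps are longer than [mu]. *)
Lemma euler_estimate a b v e i : 0 <= a -> a <= b -> good e0 b -> 0 <= e -> i ∈ d ->
  (forall s, a <= s <= b -> `|FX s i - v| <= e) ->
  `|X b i - X a i - (b - a) * v| <= (b - a) * (e + del) + del + del * `|v|.
Proof.
move=> a0 ab gb e_ge0 id Fv; have d0 := del_gt0.
pose P s := a <= s <= b /\ `|X s i - X a i - (s - a) * v| <= (s - a) * (e + del).
have [|||c c1 c2] := @real_lub M P.
- by rewrite /P; definable_tac.
- by exists a; split; [lra|rewrite !subrr !mul0r subr0 normr0].
- by exists b => s [/andP[]].
have [|s [sab sP] cs] := @lub_lt M P c (c - mu) c2; first by move: mu_gt0; lra.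
have gs : good e0 s by apply: good_le gb; move: sab a0; lra.
have [t' [m1 [m2 [m3 m4]]]] := steps gs.
have [t'b|bt'] := leP t' b.
  have : t' <= c; last by move: mu_gt0; lra.
  apply: c1; split; first by move: sab mu_gt0; lra.
  have := m4 i id; have Fvs := Fv s sab.
  have h0 : 0 <= t' - s by move: mu_gt0; lra.
  have : `|(t' - s) * (FX s i - v)| <= (t' - s) * e.
    by rewrite normrM (ger0_norm h0) ler_wpM2l.
  move: sP; rewrite !ler_norml; lra.
(* The step overshoots [b], so on [[s, b]] only the oscillation bound [del] is left, and dropping
   [(b - s) * v] costs a further [del * |v|]: these are the last two terms of the estimate. *)
have [|_ /(_ i id)] := m3 b; first by move: sab bt'; lra.
have h0 : 0 <= b - s by move: sab; lra.
have hdel : b - s <= del by move: bt' m2; lra.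
have : `|(b - s) * v| <= del * `|v| by rewrite normrM (ger0_norm h0) ler_wpM2r.
have : (s - a) * (e + del) <= (b - a) * (e + del).
  by apply: ler_wpM2r; [lra|move: sab; lra].
move: sP; rewrite !ler_norml; lra.
Qed.

(** The Euler estimate with [v = 0]: the field is at most [K + 1] at good times, so an infinitesimal
    lapse of time moves [x] infinitesimally. *)
Lemma x_near_good s t i : good e0 s -> good e0 t -> near s t -> i ∈ d -> near (X s i) (X t i).
Proof.
wlog st : s t / s <= t.
  move=> H gs gt nst id; have [st|ts] := leP s t; first exact: H.
  by apply: near_sym; apply: H => //; [exact: ltW|exact: near_sym].
move=> gs gt nst id; have [K [sK K0 KP]] := y_bound.
have [s0 tL] : 0 <= s /\ t <= L by case: gs gt => [/andP[? _] _] [/andP[_ ?] _].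
have Fb q : s <= q <= t -> `|FX q i - 0| <= K + 1.
  move=> sqt; rewrite subr0; have qL : 0 <= q <= L by move: sqt s0 tL; lra.
  have gq : good e0 q by apply: good_le gt; move: sqt s0; lra.
  have := e0_tube gq id; have [_] := KP q i qL id; have := norm_le_dist (FX q i) (FY q i); lra.
have K1 : 0 <= K + 1 by lra.
have := euler_estimate s0 st gt K1 id Fb.
rewrite mulr0 subr0 normr0 mulr0 addr0 => H; apply: near_sym.
apply/nearB; apply: small_le (_ : small ((K + 2) * (t - s) + del)); last first.
  apply: smallD del_small; apply: (@smallM _ _ (K + 2)); first by std_tac.
    by rewrite (ger0_norm (addr_ge0 (ltW K0) (ler0n _ 2))) lexx.
  exact/nearB/near_sym.
apply: le_trans H _; apply: le_trans (ler_norm _); rewrite lerD2r mulrC.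
(* As [del < 1], the nonstandard factor [K + 1 + del] may be replaced by the standard [K + 2]. *)
have := small_lt del_small (std1 M) ltr01; rewrite gtr0_norm // => d1.
by apply: ler_wpM2r; [rewrite subr_ge0|lra].
Qed.

(** Segments reach back before 0, where the closeness of [x] to [y] comes from the initial condition
    and not from [good]. *)
Definition good_time t := - r <= t /\ (0 <= t -> good e0 t).

Lemma x_near s t i : good_time s -> good_time t -> near s t -> i ∈ d -> near (X s i) (X t i).
Proof.
wlog st : s t / s <= t.
  move=> H gs gt nst id; have [st|ts] := leP s t; first exact: H.
  by apply: near_sym; apply: H => //; [exact: ltW|exact: near_sym].
move=> [rs gs] [rt gt] nst id.
have neg q q' : - r <= q <= 0 -> - r <= q' <= 0 -> near q q' -> near (X q i) (X q' i).
  move=> q0 q'0 nq; apply: near_trans (hist_near q0 id) _.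
  apply: near_trans _ (near_sym (hist_near q'0 id)); apply: y_near => //;
    by move: q0 q'0 L_gt0; lra.
have [s0|s0] := leP 0 s; first by apply: x_near_good => //; [exact: gs|apply: gt; lra].
have [t0|t0] := leP t 0; first by apply: neg => //; lra.
(* The remaining case [s < 0 < t]: both times are near 0, through which the comparison passes. *)
have ns : near s 0.
  by apply/nearB; apply: small_le (proj1 (nearB _ _) nst); rewrite subr0 !ler0_norm; lra.
have nt : near 0 t.
  by apply/nearB; apply: small_le (proj1 (nearB _ _) nst); rewrite sub0r !ler0_norm; lra.
apply: near_trans (neg s 0 _ _ ns) _; [lra|by move: r_ge0; lra|].
by apply: x_near_good => //; [exact: good0|apply: gt; lra].
Qed.

(** * The shadow of [x] below the supremum of the good times *)

Section Limit.
Variables T w0 : R.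
Hypotheses (T_ub : forall t, good e0 t -> t <= T)
  (T_lub : forall b, (forall t, good e0 t -> t <= b) -> T <= b)
  (w0_std : standard (w0 : M)) (w0_T : near w0 T) (w0_L : 0 <= w0 <= L).

Lemma good_lt t : 0 <= t -> t < T -> good e0 t.
Proof.
by move=> t0 tT; have [s gs ts] := lub_lt T_lub tT; apply: good_le gs; [|exact: ltW].
Qed.

(** [w0] may lie beyond [T], but only infinitesimally, so no standard [t < w0] fits into the gap. *)
Lemma good_std t : standard (t : M) -> 0 <= t -> t < w0 -> good e0 t.
Proof.
move=> st t0 tw; apply: good_lt => //; rewrite ltNge; apply/negP => Tt.
have : w0 <= t; last by rewrite leNgt tw.
exact: near_le (near_sym w0_T) (near_refl t) Tt w0_std st.
Qed.

Lemma good_time_std t : standard (t : M) -> - r <= t -> t < w0 -> good_time t.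
Proof. by move=> st rt tw; split=> // t0; exact: good_std. Qed.

Lemma good_time_le s t : - r <= s -> s <= t -> good_time t -> good_time s.
Proof.
move=> rs st [rt gt]; split=> // s0; apply: good_le (gt _) => //; lra.
Qed.

Lemma good_time_near t i : good_time t -> i ∈ d -> `|X t i - Y t i| <= e0.
Proof.
move=> [rt gt] id; have [t0|t0] := leP 0 t.
  by have [_ /(_ t)[|_ /(_ i id)//]] := gt t0; rewrite t0 lexx.
by apply: ltW; apply: near_lt => //; apply: hist_near => //; lra.
Qed.

Local Notation D := (Ico (ropp (real_val r)) (real_val w0)).

Lemma in_D t : (t : M) ∈ D <-> - r <= t < w0.
Proof. exact: (in_IcoE (- r) w0 t). Qed.

Lemma D_real : subset D RR.
Proof. by move=> u /in_Ico[]. Qed.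

Lemma D_std : standard D.
Proof. by rewrite /Ico; std_tac. Qed.

(** Standard parts exist because the tube keeps [x] within [e0] of the standard value of [y] at a
    standard time. *)
Lemma shadow_ex : exists z, [/\ standard z, is_fun z D (Rvec d) &
  forall t i, standard (t : M) -> (t : M) ∈ D -> i ∈ d -> near (fco z t i) (X t i)].
Proof.
apply: (shadow_vfun d_nat d_std D_std D_real) => t i st /in_D/andP[rt tw] id.
have si := standard_in_omega d_nat d_std id.
exists (`|Y t i| + e0); first by std_tac.
have := good_time_near (good_time_std st rt tw) id.
by have := norm_le_dist (X t i) (Y t i); lra.
Qed.

Section Shadow.
Variable z : M.
Hypotheses (w0_gt0 : 0 < w0) (z_std : standard z) (z_fun : is_fun z D (Rvec d))
  (z_near : forall t i, standard (t : M) -> (t : M) ∈ D -> i ∈ d -> near (fco z t i) (X t i)).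
Local Notation Z := (fco z).
Local Notation FZ := (field_along r F z).

Let zv : vector_on d D z. Proof. exact: is_fun_vector_on. Qed.

(** By transfer it suffices to look at standard points, where [z] is near [x], [x] is near [phi],
    and standard coordinates that are near are equal. *)
Lemma z_hist (u : M) : u ∈ hist -> ap z u = ap phi u.
Proof.
move: u; apply: (@transfer M (fun u => u ∈ hist -> ap z u = ap phi u)) => [|u su uh].
  by definable_tac.
have [th E] := real_ex (hist_real uh); subst u; move/in_histE: (uh) => thr.
have thD : (th : M) ∈ D by apply/in_D; move: w0_gt0 thr; lra.
have /in_Cspace[pf _] := phi_C.
apply: (fun_ext (proj1 (in_Rvec _ _) (zv thD)) (proj1 (in_Rvec _ _) (is_fun_vector_on pf uh))).
move=> i id; have si := standard_in_omega d_nat d_std id.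
rewrite (coE (zv thD) id) (coE (is_fun_vector_on pf uh) id); congr real_val.
apply: near_standard; [by std_tac|by std_tac|].
rewrite -fcoE; apply: near_trans (z_near su thD id) _; rewrite -fcoE -y_hist //.
exact: hist_near.
Qed.

(** Transfer makes [t] and [e] standard; underspill draws a standard [h] from the S-continuity of
    [x], so [s] may be taken standard too. Replacing [X] by [Z] costs [e / 8] at each time, and
    [e / 2 + e / 8 + e / 8 < e]. *)
Lemma z_continuous : continuous_on d D z.
Proof.
apply/(continuous_onE d_nat d_pos D_real zv).
have sD := D_std.
apply: real_transfer => [|t st tD]; first by definable_tac.
apply: real_transfer => [|e se e_gt0]; first by definable_tac.
have [rt tw] := andP (proj1 (in_D t) tD); have gt := good_time_std st rt tw.
have [|||h [sh h0 hP]] := @underspill M (fun h => forall s, good_time s -> `|s - t| <= h ->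
    forall i, i ∈ d -> `|X s i - X t i| <= e / 2) del _ del_gt0 del_small.
- by rewrite /good_time /good; definable_tac.
- by move=> a b a0 ab bP s gs sa; apply: bP => //; exact: le_trans sa ab.
- move=> a a0 sa s gs sta i id; have e20 : 0 < e / 2 by rewrite divr_gt0.
  have se2 : standard (real_val (e / 2)) by std_tac.
  apply: ltW; apply: near_lt se2 e20; apply: x_near => //; apply/nearB.
  by apply: small_le sa; apply: le_trans sta (ler_norm _).
exists h => //; apply: real_transfer => [|s ss sIn sth i id]; first by definable_tac.
have [rs sw] := andP (proj1 (in_D s) sIn); have gs := good_time_std ss rs sw.
have Xst := hP s gs (ltW sth) i id.
have e80 : 0 < e / 8 by rewrite divr_gt0.
have se8 : standard (real_val (e / 8)) by std_tac.
have Zs := near_lt (z_near ss sIn id) se8 e80; have Zt := near_lt (z_near st tD id) se8 e80.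
move: Zs Zt Xst; move: (Z s i) (Z t i) (X s i) (X t i) => z1 z2 x1 x2.
by rewrite !ltr_norml ler_norml; lra.
Qed.

(** At a nonstandard time the comparison goes through its standard part, by continuity of [z] and
    S-continuity of [x]. The standard bound [b < w0] keeps that standard part inside the half-open
    [D]. *)
Lemma z_x_near b t i : standard (b : M) -> b < w0 -> - r <= t <= b -> i ∈ d ->
  near (Z t i) (X t i).
Proof.
move=> sb bw rtb id; have sr : standard (real_val (- r)) by std_tac.
have [u [su ut urb]] := shadow_in sr sb rtb; have sD := D_std.
have inD s : - r <= s <= b -> (s : M) ∈ D.
  by move=> /andP[rs sb']; apply/in_D; rewrite rs; exact: le_lt_trans sb' bw.
have uD := inD u urb; have tD := inD t rtb.
have gt s : - r <= s <= b -> good_time s.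
  move=> /andP[rs sb']; apply: (good_time_le rs sb'); apply: good_time_std => //.
  exact: le_trans rs sb'.
apply: near_trans (near_trans (z_near su uD id) (x_near (gt u urb) (gt t rtb) ut id)).
exact: (standard_continuous d_nat d_pos d_std D_real zv z_continuous sD z_std su uD tD
  (near_sym ut) id).
Qed.

Lemma histD th t : - r <= th <= 0 -> 0 <= t -> - r <= t + th <= t.
Proof. by lra. Qed.

Lemma segz_Cspace t : 0 <= t -> t < w0 -> seg r z t ∈ Cspace d r.
Proof.
move=> t0 tw; apply: (seg_Cspace d_nat d_pos D_real zv (fun _ => z_continuous)) => s st.
by apply/in_D; move: r_ge0 t0 tw st; lra.
Qed.

Lemma F_near_shadow s t i : standard (t : M) -> 0 <= t -> t < w0 -> good e0 s -> near s t ->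
  i ∈ d -> near (FX s i) (FZ t i).
Proof.
move=> st t0 tw gs nst id; have s0 : 0 <= s by case: gs => /andP[].
apply: (field_near d_nat d_pos r_ge0 d_std r_std F_cont F_fun F_std t0 s0 (segz_Cspace t0 tw)
  (good_Cspace gs) st z_std nst _ id) => th j thr jd.
have rt := histD thr t0; have rs := histD thr s0.
apply: near_trans (near_sym (z_x_near st tw rt jd)).
have gt := good_std st t0 tw.
apply: x_near => //; last first.
- by apply/nearB; rewrite (_ : s + th - (t + th) = s - t); [exact/nearB|lra].
- by case/andP: rt => rt1 rt2; split=> // p0; exact: good_le gt.
- by case/andP: rs => rs1 rs2; split=> // p0; exact: good_le gs.
Qed.

(** Same transfers as for continuity. Near [t] the field along [x] stays within [e / 4] of [FZ t i],
    by [F_near_shadow] and underspill, so the Euler estimate applies between [s] and [t] with this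
    slope. *)
Lemma z_derivative t e : (t : M) ∈ D -> 0 <= t -> 0 < e ->
  exists2 h : R, 0 < h & forall s, (s : M) ∈ D -> 0 <= s -> s <> t -> `|s - t| < h ->
    forall i, i ∈ d -> `|Z s i - Z t i - (s - t) * FZ t i| <= e * `|s - t|.
Proof.
have sD := D_std; move: t e.
apply: real_transfer => [|t st]; first by definable_tac.
apply: real_transfer => [|e se tD t0 e_gt0]; first by definable_tac.
have [rt tw] := andP (proj1 (in_D t) tD).
have e40 : 0 < e / 4 by rewrite divr_gt0.
have se4 : standard (real_val (e / 4)) by std_tac.
have [|||h [sh h0 hP]] := @underspill M (fun h => forall s, good e0 s -> `|s - t| <= h ->
    forall i, i ∈ d -> `|FX s i - FZ t i| <= e / 4) del _ del_gt0 del_small.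
- by rewrite /good; definable_tac.
- by move=> a b a0 ab bP s gs sa; apply: bP => //; exact: le_trans sa ab.
- move=> a a0 sa s gs sta i id; apply: ltW; apply: near_lt se4 e40.
  apply: F_near_shadow => //; apply/nearB.
  by apply: small_le sa; apply: le_trans sta (ler_norm _).
exists h => //; apply: real_transfer => [|s ss sIn s0 sne sth i id]; first by definable_tac.
have [rs sw] := andP (proj1 (in_D s) sIn).
have gt := good_std st t0 tw; have gs := good_std ss s0 sw.
set v := FZ t i.
have si := standard_in_omega d_nat d_std id.
have sv : standard (real_val v) by rewrite /v; std_tac.
have p0 : 0 < `|s - t| by rewrite normr_gt0 subr_eq0; apply/eqP.
have Xst : `|X s i - X t i - (s - t) * v| <= `|s - t| * (e / 4 + del) + del + del * `|v|.
  have e4_ge0 := ltW e40.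
  (* The Euler estimate runs forward in time; for [s < t] it is applied from [s] to [t] and the sign
     is reversed. *)
  have [ts|lt_st] := leP t s.
    rewrite (ger0_norm (_ : 0 <= s - t)) ?subr_ge0 //.
    apply: (euler_estimate t0 ts gs e4_ge0 id) => q /andP[tq qs].
    apply: hP => //; first exact: good_le (le_trans t0 tq) qs gs.
    move: sth; rewrite !ger0_norm ?subr_ge0 //; lra.
  have := euler_estimate s0 (ltW lt_st) gt e4_ge0 id (v := v).
  have -> : `|s - t| = t - s by rewrite distrC gtr0_norm // subr_gt0.
  have -> : X t i - X s i - (t - s) * v = - (X s i - X t i - (s - t) * v) by ring.
  rewrite normrN; apply => q /andP[sq qt].
  apply: hP => //; first exact: good_le (le_trans s0 sq) qt gt.
  move: sth; rewrite (distrC s) (distrC q) !ger0_norm ?subr_ge0 ?(ltW lt_st) //; lra.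
have s1 : small (del + del * `|v|).
  apply: smallD del_small _; rewrite mulrC; apply: smallM (_ : `| `|v| | <= `|v|) del_small.
    by std_tac.
  by rewrite normr_id lexx.
(* For standard [s] distinct from [t] the number [|s - t| * (e / 8)] is standard and positive, so it
   dominates the infinitesimal remainders. Four errors of at most this size, added to the part with
   [e / 4], stay below [e * |s - t|]. *)
have e80 : 0 < e / 8 := divr_gt0 e_gt0 (ltr0Sn _ 7).
have pe0 : 0 < `|s - t| * (e / 8) := mulr_gt0 p0 e80.
have spe : standard (real_val (`|s - t| * (e / 8))) by std_tac.
have se8 : standard (real_val (e / 8)) by std_tac.
have d1 := small_lt s1 spe pe0; have d2 := small_lt del_small se8 e80.
have Zs := near_lt (z_near ss sIn id) spe pe0; have Zt := near_lt (z_near st tD id) spe pe0.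
move: Zs Zt Xst d1 d2; rewrite (gtr0_norm del_gt0).
move: (Z s i) (Z t i) (X s i) (X t i) => z1 z2 x1 x2.
move: p0 del_gt0; set p := `|s - t|; set q := (s - t) * v; set w := del * `|v|.
move=> p0 d0 Zs Zt Xst d1 d2.
have pd : p * del <= p * (e / 8) by rewrite ler_wpM2l // ltW.
have {}d1 : del + w < p * (e / 8) by apply: le_lt_trans d1; exact: ler_norm.
move: Zs Zt Xst; rewrite !mulrDr !ltr_norml !ler_norml.
move: d1 pd; clear d2; move: (p * del) => pdel.
have -> : p * (e / 8) = p * e / 8 by ring.
have -> : p * (e / 4) = p * e / 4 by ring.
by rewrite [e * p]mulrC; move: (p * e) => pe; lra.
Qed.

Lemma z_solution : solution d r F phi z D.
Proof.
have rw : - r <= 0 <= w0 by move: r_ge0 w0_gt0; lra.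
split; first split; first exact: D_real.
  split; first by apply/(in_D (- r)); move: r_ge0 w0_gt0; lra.
  split=> [u /in_Ico[_ []]//|u v w /in_Ico[_ [ru _]] /in_Ico[vR [_ [vw vw']]] uw wv].
  have [wR _] := rle_in wv; apply/in_Ico; split=> //; split.
    exact: (real_le_trans _ _ (rm_axioms M)) ru uw.
  have [a E] := real_ex wR; subst w; have [b E] := real_ex vR; subst v.
  have : b < w0 by apply/rltE.
  by move/rleE: wv => ab bw; apply/rltE; exact: le_lt_trans ab bw.
split.
  exists (real_val (w0 / 2)); split; last by apply/rlt0E; move: w0_gt0; lra.
  by apply/(in_D (w0 / 2)); move: r_ge0 w0_gt0; lra.
split; first exact: z_fun.
split; first exact: z_continuous.
split; first exact: z_hist.
move=> u uD /[dup] /rle_in[_ /real_ex[t E]]; subst u => /rle0E t0.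
have [rt tw] := andP (proj1 (in_D t) uD).
pose (E := setof (fun v : M => v ∈ D /\ rle rzero v)).
have inE (v : M) : v ∈ E <-> v ∈ D /\ rle rzero v.
  by apply: (@in_setof_sub M (fun v => v ∈ D /\ rle rzero v) D) => [|v' []//]; definable_tac.
have ER : subset E RR by move=> s /inE[/D_real].
have Ev : vector_on d E z by move=> s /inE[sD _]; exact: zv.
apply: (has_derivativeI d_nat d_pos ER Ev).
- by apply/inE; split=> //; apply/rle0E.
- exact: (F_vector F_fun t0 (segz_Cspace t0 tw)).
move=> e e_gt0; have [h h0 hP] := z_derivative uD t0 e_gt0; exists h => //.
move=> s /inE[sD /rle0E s0] /eqP sne sth i id.
by have := hP s sD s0 sne sth i id; rewrite field_alongE.
Qed.

Lemma x_near_y_std t i : standard (t : M) -> (t : M) ∈ D -> i ∈ d -> near (X t i) (Y t i).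
Proof.
move=> st tD id; have zy := y_unique z_solution.
have [_ E] := ap_eq y_fun (zy _ (proj2 (fun_ap z_fun tD))).
have <- : Z t i = Y t i by have E1 := fcoE z i t; have E2 := fcoE y i t; rewrite -> E1, E2, E.
by apply: near_sym; exact: z_near.
Qed.

(** Closeness at standard times below [w0] spreads to all good times through the standard part [u],
    except when [u = w0], a time that [z] does not reach. *)
Lemma x_near_y_pos t i : good e0 t -> i ∈ d -> near (X t i) (Y t i).
Proof.
move=> gt id; have [tL _] := gt; have [t0 tL'] := andP tL.
have [u [su ut /andP[u0 uL]]] := shadow_in (std_natr M 0) L_std tL.
have rt : good_time t by split=> //; apply: le_trans t0; move: r_ge0; lra.
have uw : u <= w0 by exact: near_le (near_sym ut) (near_sym w0_T) (T_ub gt) su w0_std.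
have [uw'|wu] := ltP u w0.
  have ru : - r <= u by move: r_ge0; lra.
  have uD : (u : M) ∈ D by apply/in_D; rewrite ru uw'.
  apply: near_trans (x_near rt (good_time_std su ru uw') (near_sym ut) id) _.
  apply: near_trans (x_near_y_std su uD id) _.
  by apply: y_near => //; move: r_ge0; lra.
have uE : u = w0 by apply/eqP; rewrite eq_le uw wu.
(* Detour through a standard [s < w0] close to [w0]: from [x] at [t] to [x] at [s], to [y] at [s],
   to [y] at [t], each within [e], hence the factor 3. *)
subst u; apply/nearB; apply: (@small_scale _ _ 3) => [|e se e_gt0]; first exact: std_natr.
have [|||h [sh h0 hP]] := @underspill M (fun h => forall s, good e0 s -> w0 - h <= s -> s <= w0 ->
    `|X t i - X s i| <= e /\ `|Y s i - Y t i| <= e) del _ del_gt0 del_small.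
- by rewrite /good; definable_tac.
- by move=> a b a0 ab bP s gs ws; apply: bP gs (le_trans (lerB (lexx w0) ab) ws).
- move=> a a0 sa s gs ws sw.
  have ns : near t s.
    apply: near_trans (near_sym ut) _; apply/nearB; apply: small_le sa.
    rewrite (gtr0_norm a0) ger0_norm; last by rewrite subr_ge0.
    by move: ws; lra.
  have gts : good_time s by split=> //; case: gs => /andP[s0 _] _; move: r_ge0; lra.
  split; apply: ltW.
    exact: near_lt (x_near rt gts ns id) se e_gt0.
  apply: near_lt se e_gt0; apply: y_near id; [| |exact: near_sym].
    by case: gs => sL _; move: sL r_ge0; lra.
  by move: tL r_ge0; lra.
(* The maximum with 0 keeps [s] among the good times when [h] exceeds [w0]. *)
pose s : R := Num.max 0 (w0 - h).
have ss : standard (real_val s) by rewrite /s /Num.max; case: ifP => _; std_tac.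
have s0 : 0 <= s by rewrite le_max lexx.
have sw : s < w0 by rewrite gt_max w0_gt0 ltrBlDr ltrDl.
have hs : w0 - h <= s by rewrite le_max lexx orbT.
have gs := good_std ss s0 sw; have [X1 Y1] := hP s gs hs (ltW sw).
have sD : (s : M) ∈ D by apply/in_D; rewrite sw andbT; move: r_ge0; lra.
have := near_lt (x_near_y_std ss sD id) se e_gt0; move: X1 Y1.
move: (X t i) (X s i) (Y s i) (Y t i) => x1 x2 y1 y2.
by rewrite !ltr_norml !ler_norml; lra.
Qed.

End Shadow.

Lemma x_near_y t i : good e0 t -> i ∈ d -> near (X t i) (Y t i).
Proof.
move=> gt id; have [/andP[t0 tL] _] := gt; have [w00 _] := andP w0_L.
have [w0_gt0|w0_le0] := ltP 0 w0.
  by have [z [sz zf zn]] := shadow_ex; exact: (x_near_y_pos w0_gt0 sz zf zn).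
(* For [w0 = 0] there is no shadow on positive times, but then every good time is squeezed between 0
   and the infinitesimal [T]. *)
have t_small : near t 0.
  have {w0_le0} w0E : w0 = 0 by apply/eqP; rewrite eq_le w0_le0.
  have T0 : near T 0 by rewrite -w0E; exact: near_sym.
  apply/nearB; apply: small_le (proj1 (nearB _ _) T0).
  have T_ge := T_ub gt.
  by rewrite !subr0 (ger0_norm t0) (ger0_norm (le_trans t0 T_ge)).
apply: near_trans (x_near_good gt good0 t_small id) _.
have r00 : - r <= (0 : R) <= 0 by move: r_ge0; lra.
have yt : near (Y 0 i) (Y t i).
  by apply: y_near => //; [move: r_ge0 L_gt0|move: r_ge0 t0 tL|exact: near_sym]; lra.
exact: near_trans (hist_near r00 id) yt.
Qed.

End Limit.

(* Beyond the supremum of the good times there is one more step. *)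
Lemma good_L : good e0 L /\ forall t i, good e0 t -> i ∈ d -> near (X t i) (Y t i).
Proof.
have [|||T T_ub T_lub] := @real_lub M (good e0).
- by rewrite /good; definable_tac.
- by exists 0; exact: good0.
- by exists L => t [/andP[]].
have TL : 0 <= T <= L by rewrite (T_ub _ good0) T_lub // => t [/andP[]].
have [w0 [sw w0T w0L]] := shadow_in (std_natr M 0) L_std TL.
have near_good t i : good e0 t -> i ∈ d -> near (X t i) (Y t i).
  exact: (x_near_y T_ub T_lub sw w0T w0L).
split=> //; have Tmu : T - mu < T by rewrite ltrBlDr ltrDl.
have [t gt Tt] := lub_lt T_lub Tmu.
have [t' [m1 [m2 [m3 _]]]] := steps gt.
have [/andP[t0 tL] tP] := gt.
have tt' : t <= t' by rewrite -subr_ge0; exact: ltW (lt_trans mu_gt0 m1).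
have ext s : 0 <= s -> s <= t' -> s <= L ->
    (s : M) ∈ I /\ forall i, i ∈ d -> `|X s i - Y s i| <= e0.
  move=> s0 st' sL; have [st|ts] := leP s t; first by apply: tP; rewrite s0 st.
  have [|sI sP] := m3 s; first by rewrite (ltW ts).
  split=> // i id; apply: ltW; apply: near_lt e0_std e0_gt0.
  have nts : near t s.
    apply/nearB; apply: small_le del_small.
    rewrite (gtr0_norm del_gt0) distrC gtr0_norm ?subr_gt0 //.
    by apply: le_trans m2; rewrite lerB.
  have nX : near (X s i) (X t i).
    apply/nearB; apply: small_le del_small.
    by apply: le_trans (sP i id) _; exact: ler_norm.
  apply: near_trans nX (near_trans (near_good t i gt id) _).
  by apply: y_near => //; move: r_ge0 t0 tL s0 sL; lra.
have [Lt'|t'L] := leP L t'.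
  split=> [|s /andP[s0 sL]]; first by rewrite lexx (ltW L_gt0).
  by apply: ext => //; exact: le_trans Lt'.
have gt' : good e0 t'.
  split=> [|s /andP[s0 st']]; first by rewrite (le_trans t0 tt') (ltW t'L).
  by apply: ext => //; exact: le_trans st' (ltW t'L).
by have := T_ub t' gt'; move: Tt m1; lra.
Qed.

End Steps.
End Tube.

Lemma stroboscopy : subset (Icc (ropp (real_val r)) L) I /\
  forall u, u ∈ Icc (ropp (real_val r)) L -> vnear d (ap x u) (ap y u).
Proof.
have [e0 [se e0_gt0 tube]] := tube_ex.
have [mu [del [mu0 sd d0 st]]] := fine_steps se e0_gt0 tube.
have [gL nxy] := good_L se e0_gt0 tube mu0 sd d0 st.
have inL u : u ∈ Icc (ropp (real_val r)) L -> exists t : R, u = t /\ (- r <= t <= L).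
  move=> uL; have [/real_ex[t E] _] := proj1 (in_Icc _ _ _) uL; subst u.
  by exists t; split=> //; exact: (proj1 (in_IccE (- r) L t)).
have sub : subset (Icc (ropp (real_val r)) L) I.
  by move=> u /inL[t [-> rtL]]; exact: good_in gL rtL.
split; first exact: sub.
move=> u uL; have uI := sub u uL; have [t [E rtL]] := inL u uL; subst u.
have [rt tL] := andP rtL.
apply/(vnearE d_nat d_pos (xv uI) (yv (in_J rtL))) => i id.
have E1 := fcoE x i t; have E2 := fcoE y i t; rewrite <- E1, <- E2.
have [t0|t0] := leP 0 t; first by apply: nxy => //; exact: good_le gL.
by apply: hist_near => //; rewrite rt (ltW t0).
Qed.

End Stroboscopy.

(** Transfer produces one standard object at a time: first a standard solution, then a standard
    domain for it. Uniqueness identifies the solutions, and the domains coincide because each is the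
    set of first components of the same function. *)
Lemma unique_solution_standard (M : real_model) (d r F phi y J : M) :
  standard d -> standard r -> standard F -> standard phi ->
  unique_solution d r F phi y J -> standard y /\ standard J.
Proof.
move=> sd sr sF sphi yJ; have [yM [yU _]] := yJ.
have [||y' [sy' y'E]] := @transfer_ex M (fun y => exists J, unique_solution d r F phi y J).
- by rewrite /unique_solution; definable_tac.
- by exists y, J.
have [||J' [sJ' y'J']] := @transfer_ex M (fun J => unique_solution d r F phi y' J).
- by rewrite /unique_solution; definable_tac.
- by case: y'E => J'; exists J'.
have [y'M _] := y'J'; have E := yU _ _ y'M; subst y'; split=> //.
have yf : is_fun y J (Rvec d) by case: yM => -[_ [_ []]].
have yf' : is_fun y J' (Rvec d) by case: y'M => -[_ [_ []]].
suff <- : J' = J by [].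
apply: ext_eq => a; split=> aJ.
  by have [] := ap_eq yf (proj2 (fun_ap yf' aJ)).
by have [] := ap_eq yf' (proj2 (fun_ap yf aJ)).
Qed.

Local Open Scope ist_scope.

Theorem theorem3p8 (U : universe) (HU : IST U)
    (K : real_data U) (HK : is_real_line U K)
    (d : U) (d_nat : d ∈ omega) (d_pos : d <> empty) (d_std : standard d)
    (r : U) (r_real : r ∈ RR) (r_ge0 : 0 <= r) (r_std : standard r)
    (phi : U) (phi_C : phi ∈ Cspace d r) (phi_std : standard phi)
    (F : U) (F_fun : is_fun F (prod (Ici 0) (Cspace d r)) (Rvec d))
    (F_cont : continuous_functional d r F) (F_std : standard F)
    (I : U) (I_sub : subset I RR) (I_init : subset (Icc (- r) 0) I)
    (x : U) (x_fun : is_fun x I (Rvec d))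
    (x_cont : 0 < r -> continuous_on d I x)
    (x_init : Cnear d r (seg r x 0) phi)
    (x_strob : stroboscopic d r F I x)
    (y J : U) (y_sol : unique_solution d r F phi y J)
    (J_form : (exists omega', omega' ∈ RR /\ 0 < omega' /\ J = Ico (- r) omega') \/
              J = Ici (- r)) :
  forall L, standard L -> L ∈ J -> 0 < L ->
    subset (Icc (- r) L) I /\
    forall t, t ∈ Icc (- r) L -> vnear d (ap x t) (ap y t).
Proof.
pose M := @RealModel (IstModel HU) K HK.
move=> L L_std L_J L_gt0.
have [y_std J_std] := @unique_solution_standard M _ _ _ _ _ _ d_std r_std F_std phi_std y_sol.
have [r' rE] := @real_ex M r r_real.
have [L' LE] := @real_ex M L (proj1 (proj1 (proj1 (proj1 y_sol))) L L_J).
subst r L; have [[sol _] [_ uniq]] := y_sol.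
exact: (@stroboscopy M d r' d_nat d_pos d_std (proj1 (@rle0E M r') r_ge0) r_std phi F
  phi_C phi_std F_fun F_cont F_std I x I_sub I_init x_fun
  (fun h => x_cont (proj2 (@rlt0E M r') h)) x_init x_strob y J y_std J_std sol uniq L'
  L_std L_J (proj1 (@rlt0E M L') L_gt0)).
Qed.
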